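(* Let $\mathcal{L}\subset \mathbb{P}^{2}_{\mathbb{C}}$ be an arrangement of $d$ lines whose only intersection points are nodes (double points) and triple points, and suppose $\mathcal{L}$ is minimal plus-one generated. Then the weak-combinatorics of $\mathcal{L}$ is one of $$(d;n_{2},n_{3}) \in \{(6;9,2),(7;9,4),(8;7,7),(9;6,10)\}.$$ Moreover, each of these four weak-combinatorics is realized by a minimal plus-one generated arrangement of lines (with only double and triple points) defined over the real numbers.
   Context: Let $S=\mathbb{C}[x,y,z]$. For a reduced plane curve $C: f=0$ of degree $d$, the Milnor algebra is $M(f)=S/J_f$, where $J_f=\langle \partial_x f,\partial_y f,\partial_z f\rangle$ is the Jacobian ideal. $C$ is an $m$-syzygy curve if $M(f)$ has a minimal graded free resolution of the form $0 \to \bigoplus_{i=1}^{m-2}S(-e_i) \to \bigoplus_{i=1}^{m}S(1-d-d_i)\to S^3(1-d)\to S\to M(f)\to 0$ with $e_1\le\dots\le e_{m-2}$ and $1\le d_1\le\dots\le d_m$; $(d_1,\dots,d_m)$ are the exponents. $C$ is plus-one generated if it is a $3$-syzygy curve with exponents $(d_1,d_2,d_3)$ satisfying $d_1+d_2=d$; it is minimal plus-one generated if moreover $d_3-d_2=1$. For a line arrangement $\mathcal{L}$ of $d$ lines, $n_i$ denotes the number of points where exactly $i$ lines meet, and the weak-combinatorics is $(d;n_2,n_3)$ when only double and triple points occur. *)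

(* Defs.v *)
From HB Require Import structures.
From mathcomp Require Import all_boot all_algebra.
From mathcomp Require Import boolp.
From mathcomp Require Import Rstruct.
From mathcomp Require Import complex.
From mathcomp Require Import mpoly.

Set Implicit Arguments.
Unset Strict Implicit.
Unset Printing Implicit Defensive.

Import GRing.Theory.
Local Open Scope ring_scope.

Definition R := Rdefinitions.R.
Definition C : numClosedFieldType := complex R.

Definition RtoC (x : R) : C := Complex x 0.

Definition o0 : 'I_3 := ord0.
Definition o1 : 'I_3 := inord 1.
Definition o2 : 'I_3 := ord_max.

Notation S := {mpoly C[3]}.

Definition linform (a : 'I_3 -> C) : S := \sum_(k < 3) a k *: 'X_k.

Definition line_arrangement (d : nat) (l : 'I_d -> 'I_3 -> C) : Prop :=
  (forall i, exists k, l i k != 0) /\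
  (forall i j, i != j -> ~ (exists c : C, forall k, l i k = c * l j k)).

Definition defpoly (d : nat) (l : 'I_d -> 'I_3 -> C) : S :=
  \prod_(i < d) linform (l i).

(* Membership in the irrelevant (maximal homogeneous) ideal (x,y,z):
   vanishing constant term.  Used to express minimality of the resolution. *)
Definition in_max_ideal (p : S) : Prop := p@_0%MM = 0.

Definition is_syz (f : S) (s : 'I_3 -> S) : Prop :=
  \sum_(k < 3) s k * mderiv k f = 0.

(* f (of degree d) is a 3-syzygy curve with exponents (dd 0, dd 1, dd 2):
   M(f) = S/J_f has a minimal graded free resolution
     0 -> S(-e) -> (+)_{j<3} S(1-d-dd j) -> S^3(1-d) -> S -> M(f) -> 0.
   Spelled out:
   - the map S^3(1-d) -> S is (f_x, f_y, f_z) (its cokernel is M(f) by def.);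
   - the map (+)_j S(1-d-dd j) -> S^3(1-d) sends the j-th basis vector to
     r j = (r j 0, r j 1, r j 2), homogeneous of degree dd j (graded map);
     exactness at S^3(1-d): the r j are syzygies and generate all syzygies;
   - the map S(-e) -> (+)_j S(1-d-dd j) is given by h = (h 0, h 1, h 2),
     with h j homogeneous of degree e+1-d-dd j (graded map); it is injective
     (h <> 0) and its image is the kernel of the previous map;
   - minimality: all matrix entries lie in the maximal ideal (x,y,z);
   - 1 <= dd 0 <= dd 1 <= dd 2. *)
Definition three_syzygy (f : S) (d : nat) (dd : 'I_3 -> nat) : Prop :=
  [/\ (1 <= dd o0)%N, (dd o0 <= dd o1)%N, (dd o1 <= dd o2)%N,
  (forall k, in_max_ideal (mderiv k f)) &
  (exists (r : 'I_3 -> 'I_3 -> S) (e : nat) (h : 'I_3 -> S) (kh : 'I_3 -> nat),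
    [/\ (forall j c, r j c \is (dd j).-homog),
        (forall j, is_syz f (r j)),
        (forall s, is_syz f s ->
           exists g : 'I_3 -> S, forall c, s c = \sum_(j < 3) g j * r j c),
        (forall j c, in_max_ideal (r j c)) &
     [/\ (forall j, h j \is (kh j).-homog /\ (e + 1 = kh j + dd j + d)%N),
        (exists j, h j != 0),
        (forall j, in_max_ideal (h j)) &
        (forall g : 'I_3 -> S,
           (forall c, \sum_(j < 3) g j * r j c = 0) <->
           (exists t : S, forall j, g j = t * h j))]])].

Definition plus_one_generated (f : S) (d : nat) : Prop :=
  exists dd : 'I_3 -> nat, three_syzygy f d dd /\ (dd o0 + dd o1 = d)%N.

Definition minimal_plus_one_generated (f : S) (d : nat) : Prop :=
  exists dd : 'I_3 -> nat,
    [/\ three_syzygy f d dd, (dd o0 + dd o1 = d)%N & dd o2 = (dd o1).+1].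

Definition on_line (a v : 'I_3 -> C) : bool := \sum_(k < 3) a k * v k == 0.

Definition exact_point_set (d : nat) (l : 'I_d -> 'I_3 -> C)
    (Sl : {set 'I_d}) : Prop :=
  exists v : 'I_3 -> C, (exists k, v k != 0) /\
    (forall i, on_line (l i) v = (i \in Sl)).

(* n_k: number of points of P^2 where exactly k lines meet (k >= 2), counted
   through the (bijective, for k >= 2 and distinct lines) correspondence
   point |-> set of lines through it. *)
Definition nmult (d : nat) (l : 'I_d -> 'I_3 -> C) (k : nat) : nat :=
  #|[set Sl : {set 'I_d} | (#|Sl| == k) && `[< exact_point_set l Sl >]]|.

Definition only_double_triple (d : nat) (l : 'I_d -> 'I_3 -> C) : Prop :=
  forall k, (4 <= k)%N -> nmult l k = 0%N.

Definition MPOG_weak_combinatorics : seq (nat * nat * nat) :=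
  [:: (6, 9, 2); (7, 9, 4); (8, 7, 7); (9, 6, 10)]%N.

(* Main.v *)
Require Import Defs.
From HB Require Import structures.
From Stdlib Require BinInt.
From mathcomp Require Import all_boot all_order all_algebra.
From mathcomp Require Import boolp Rstruct complex mpoly.
From mathcomp Require Import qpoly ring zify ssrZ.

(** Write [D_k] for the space of vector fields with coefficients of degree [k]
    that are tangent to every line of the arrangement [f = 0].  It is the direct
    sum of the syzygies of degree [k] and of the multiples of the Euler field,
    so the resolution gives its dimension in terms of the exponents.  Adding the
    lines one at a time and restricting to the new line gives, for [k] large,
    [dim D_k = 3 binom(k+2, 2) - d (k+1) + n_3].  Comparing both polynomials in
    [k] yields [2 n_3 = d_1^2 + d_2^2 - d_1 - 3 d_2 - 2], and counting pairs of
    lines gives [n_2]; only finitely many triples [(d, n_2, n_3)] survive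
    [n_2 >= 0].  The ones outside the list are excluded by the parity of the
    number of double points on a line, or as follows.  Let [D] be a syzygy of
    degree [r], [E] the Euler field, and suppose that [r] lines carry at least
    [r + 2] points each.  Then [D x E], of degree [r + 1], vanishes on these
    lines, so it is the product of their equations times [c x E] for a constant
    vector [c]; if [c = 0] then [D] is a multiple of [E], hence zero, and
    otherwise all the other lines pass through the point [c].

    Conversely, three syzygies [r_0, r_1, r_2] with one relation [h] generate
    all syzygies as soon as [det (r_0, r_1, E)] is a nonzero multiple of [h_2 f]
    with [h_2] linear and [h_0, h_1] are coprime modulo [h_2].  Four explicit
    arrangements are checked against this criterion. *)

Set Implicit Arguments.
Unset Strict Implicit.
Unset Printing Implicit Defensive.
Import Order.TTheory GRing.Theory Num.Theory.
Local Open Scope ring_scope.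
Notation S := {mpoly C[3]}.

(** * Polynomials vanishing on planes *)

(** Polynomials are treated as functions on C^3. Divisibility by a linear form and coprimality
    modulo one are read off from values on planes: vanishing on a set closed under joining lines is
    a prime condition because C[t] is a domain, and this replaces quotient rings and unique
    factorisation. In the restriction step, the zeros at the triple points completed by the new line
    are forced. That nothing else is forced is an interpolation statement, and it needs room: this
    is the origin of the bound [d <= k]. No Hilbert polynomial appears. Both dimension formulas hold
    for every [k] past an explicit bound; two consecutive values of [k] give the degree of the
    relation [h], and one of them then gives [n_3]. The determinant condition of the converse is a
    relative of Saito's criterion: for a free arrangement the determinant with the Euler field is a
    constant times [f], and the linear factor [h_2] measures the defect. *)

Lemma big_ord3 (V : nmodType) (F : 'I_3 -> V) : \sum_k F k = F o0 + F o1 + F o2.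
Proof.
rewrite !big_ord_recl big_ord0 addr0 addrA; congr (F _ + F _ + F _); apply: val_inj => //=.
by rewrite inordK.
Qed.

Lemma ord3P (P : 'I_3 -> Prop) : P o0 -> P o1 -> P o2 -> forall k, P k.
Proof.
move=> P0 P1 P2 [[|[|[|//]]] ki].
- by have -> : Ordinal ki = o0 by apply: val_inj.
- by have -> : Ordinal ki = o1 by apply: val_inj; rewrite /= inordK.
- by have -> : Ordinal ki = o2 by apply: val_inj.
Qed.

Definition addv3 (t : C) (v w : 'I_3 -> C) : 'I_3 -> C := fun k => v k + t * w k.

(** Pull-back along [t |-> v + t w]; through it, identities in three variables become identities in
    C[t]. *)
Definition pline (v w : 'I_3 -> C) (p : S) : {poly C} :=
  mmap (@polyC C) (fun k => (v k)%:P + (w k) *: 'X) p.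

HB.instance Definition _ v w := GRing.RMorphism.copy (pline v w) (mmap (@polyC C) (fun k => (v k)%:P + (w k) *: 'X)).

Lemma plineC v w c : pline v w c%:MP = c%:P. Proof. exact: mmapC. Qed.
Lemma plineZ v w c p : pline v w (c *: p) = c *: pline v w p.
Proof. by rewrite /pline mmapZ mul_polyC. Qed.
Lemma plineX v w k : pline v w 'X_k = (v k)%:P + (w k) *: 'X.
Proof. by rewrite /pline mmapX mmap1U. Qed.

Lemma mpoly_ringind (P : S -> Prop) :
  (forall c, P c%:MP) -> (forall k, P 'X_k) ->
  (forall p q, P p -> P q -> P (p + q)) ->
  (forall p q, P p -> P q -> P (p * q)) -> forall p, P p.
Proof.
move=> hC hX hD hM; apply: mpolyind => [|c m p _ _ Pp].
  by rewrite -mpolyC0; apply: hC.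
apply: hD => //; rewrite -mul_mpolyC; apply: (hM) => //.
rewrite mpolyXE_id; apply: (big_ind P) => [||i _]; [by rewrite -mpolyC1; apply: (hC)|by move=> *; apply: (hM)|].
elim: (m i) => [|e IH]; first by rewrite expr0 -mpolyC1; apply: hC.
by rewrite exprS; apply: hM.
Qed.

Lemma pline_eval v w p t : (pline v w p).[t] = p.@[addv3 t v w].
Proof.
elim/mpoly_ringind: p => [c|k|p q Hp Hq|p q Hp Hq].
- by rewrite plineC hornerC mevalC.
- by rewrite plineX mevalXU !hornerE /addv3 mulrC.
- by rewrite raddfD /= hornerD Hp Hq mevalD.
- by rewrite rmorphM /= hornerM Hp Hq mevalM.
Qed.

(** The chain rule; it carries the vanishing of a function over to its partial derivatives. *)
Lemma deriv_pline v w p : (pline v w p)^`() = \sum_k w k *: pline v w (mderiv k p).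
Proof.
elim/mpoly_ringind: p => [c|j|p q Hp Hq|p q Hp Hq].
- by rewrite plineC derivC big1 // => k _; rewrite mderivC raddf0 scaler0.
- rewrite plineX derivD derivC derivZ derivX add0r (bigD1 j) //= big1 => [|k kj].
    by rewrite mderivX mnmE eqxx scale1r addr0 (_ : (U_(j) - U_(j))%MM = 0%MM) ?mpolyX0 ?rmorph1 //; apply/mnmP => i; rewrite !mnmE subnn.
  by rewrite mderivX mnmE eq_sym (negbTE kj) scale0r raddf0 scaler0.
- rewrite raddfD /= derivD Hp Hq -big_split; apply: eq_bigr => k _ /=.
  by rewrite mderivD raddfD scalerDr.
- rewrite rmorphM /= derivM Hp Hq mulr_suml mulr_sumr -big_split.
  apply: eq_bigr => k _ /=.
  by rewrite mderivM raddfD /= !rmorphM /= scalerDr scalerAl scalerAr.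
Qed.

Lemma poly_eval0 (p : {poly C}) : (forall t, p.[t] = 0) -> p = 0.
Proof.
move=> p0; apply: (@roots_geq_poly_eq0 _ _ [seq i%:R | i <- iota 0 (size p)]).
- by apply/allP => x _; rewrite rootE p0.
- by rewrite map_inj_uniq ?iota_uniq // => i j /eqP; rewrite eqr_nat => /eqP.
- by rewrite size_map size_iota.
Qed.

Lemma mcoeff0E (p : S) : p@_0%MM = p.@[fun=> 0].
Proof.
elim/mpoly_ringind: p => [c|k|p q Hp Hq|p q Hp Hq].
- by rewrite mevalC mcoeffC eqxx mulr1.
- by rewrite mevalXU mcoeffX; case: eqP => // /mnmP /(_ k); rewrite !mnmE eqxx.
- by rewrite mcoeffD mevalD Hp Hq.
- by rewrite (mcoeff0_is_multiplicative _ _).1 mevalM Hp Hq.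
Qed.

(** A function that vanishes identically has vanishing partial derivatives, so induction on the
    degree of the monomial reduces to the constant term. Characteristic zero recovers a coefficient
    from that of the derivative. *)
Lemma mpoly_eval0 (p : S) : (forall v, p.@[v] = 0) -> p = 0.
Proof.
suff H n m (q : S) : mdeg m = n -> (forall v, q.@[v] = 0) -> q@_m = 0.
  by move=> p0; apply/mpolyP => m; rewrite mcoeff0; apply: H p0.
elim: n m q => [|n IH] m q mn q0.
  have /eqP -> : m == 0%MM by rewrite -mdeg_eq0 mn.
  by rewrite mcoeff0E.
have [i mi] : exists i, (0 < m i)%N.
  apply: contrapT => /forallNP H; move: mn; rewrite mdegE big1 // => i _.
  by apply/eqP; rewrite -leqn0 leqNgt; apply/negP/H.
have mE : (m = (m - U_(i)) + U_(i))%MM.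
  by apply/mnmP => j; rewrite !mnmE; case: (eqVneq i j) mi => [->|_] /=; lia.
have dq0 v : (mderiv i q).@[v] = 0.
  pose e : 'I_3 -> C := fun k => (k == i)%:R.
  have p0 : pline v e q = 0 by apply: poly_eval0 => t; rewrite pline_eval.
  have := deriv_pline v e q; rewrite p0 deriv0 => /(congr1 (fun p => p.[0])) /=.
  rewrite horner0 (bigD1 i) //= big1 => [|k ki]; last by rewrite /e (negbTE ki) scale0r.
  rewrite addr0 /e eqxx scale1r pline_eval => /esym; apply: etrans; apply: meval_eq => k.
  by rewrite /addv3 mul0r addr0.
have md : mdeg (m - U_(i))%MM = n by move: mn; rewrite {1}mE mdegD mdeg1 addn1 => -[].
by have /eqP := IH _ _ md dq0; rewrite mcoeff_mderiv -mE mulrn_eq0 /= => /eqP.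
Qed.

Definition vanish (W : ('I_3 -> C) -> Prop) (p : S) := forall v, W v -> p.@[v] = 0.

(** Closure under the line through two points is what makes vanishing on [W] a prime condition. *)
Definition affine_closed (W : ('I_3 -> C) -> Prop) :=
  forall v w t, W v -> W w -> W (addv3 t v (fun k => w k - v k)).

(** If [p] is nonzero at [w] and [q] at [v], both restrict to nonzero polynomials on the line
    joining these points, and C[t] has no zero divisors. *)
Lemma vanish_prime W p q : affine_closed W -> vanish W (p * q) -> ~ vanish W p -> vanish W q.
Proof.
move=> clW pq0 np v Wv; apply: contrapT => qv; apply: np => w Ww; apply: contrapT => pw.
pose u k := w k - v k.
have ev1 r : (pline v u r).[1] = r.@[w].
  by rewrite pline_eval; apply: meval_eq => k; rewrite /addv3 /u mul1r addrC subrK.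
have ev0 r : (pline v u r).[0] = r.@[v].
  by rewrite pline_eval; apply: meval_eq => k; rewrite /addv3 /u mul0r addr0.
have : pline v u (p * q) = 0.
  by apply: poly_eval0 => t; rewrite pline_eval; apply: pq0; apply: clW.
rewrite rmorphM => /eqP; rewrite mulf_eq0 => /orP[/eqP E|/eqP E].
  by apply: pw; rewrite -ev1 E horner0.
by apply: qv; rewrite -ev0 E horner0.
Qed.

Definition dot (a v : 'I_3 -> C) : C := \sum_k a k * v k.

Lemma meval_linform a v : (linform a).@[v] = dot a v.
Proof. by rewrite /linform raddf_sum; apply: eq_bigr => k _; rewrite /= mevalZ mevalXU. Qed.

Lemma dot_addv3 a t v w : dot a (addv3 t v w) = dot a v + t * dot a w.
Proof. by rewrite /dot !big_ord3 /addv3; ring. Qed.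

Definition plane a v := dot a v = 0.

Lemma dotB a v w : dot a (fun k => v k - w k) = dot a v - dot a w.
Proof. by rewrite /dot !big_ord3; ring. Qed.

Lemma plane_closed a : affine_closed (plane a).
Proof. by move=> v w t; rewrite /plane dot_addv3 dotB => -> ->; ring. Qed.

Lemma affine_closedI W1 W2 : affine_closed W1 -> affine_closed W2 -> affine_closed (fun v => W1 v /\ W2 v).
Proof. by move=> h1 h2 v w t [? ?] [? ?]; split; [apply: h1|apply: h2]. Qed.

(* Projection onto the plane [a = 0] along the [k]-th axis; junk when [a k = 0]. *)
Definition proj3 (a : 'I_3 -> C) (k : 'I_3) (v : 'I_3 -> C) : 'I_3 -> C :=
  fun j => v j - (j == k)%:R * (dot a v / a k).

Lemma dot_proj3 a b k v : dot b (proj3 a k v) = dot b v - b k * (dot a v / a k).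
Proof.
rewrite /dot /proj3 (eq_bigr (fun j => b j * v j - b j * (j == k)%:R * (dot a v / a k))).
  rewrite sumrB; congr (_ - _); rewrite (bigD1 k) //= big1 ?addr0 ?eqxx ?mulr1 //.
  by move=> j /negbTE ->; rewrite mulr0 mul0r.
by move=> j _; rewrite mulrBr -!mulrA.
Qed.

Lemma plane_proj3 a k v : a k != 0 -> plane a (proj3 a k v).
Proof. by move=> ak; rewrite /plane dot_proj3 mulrCA divff // mulr1 subrr. Qed.

(** Elimination of [X_k] by means of [a]: the substitution changes each variable, hence every
    polynomial, by a multiple of [linform a]. *)
Lemma proj3_mpoly a k (p : S) : a k != 0 ->
  exists p', (forall v, p'.@[v] = p.@[proj3 a k v]) /\ exists q, p = p' + linform a * q.
Proof.
move=> ak; elim/mpoly_ringind: p => [c|j|p1 p2 [p1' [e1 [q1 d1]]] [p2' [e2 [q2 d2]]]|p1 p2 [p1' [e1 [q1 d1]]] [p2' [e2 [q2 d2]]]].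
- exists c%:MP; split=> [v|]; first by rewrite !mevalC.
  by exists 0; rewrite mulr0 addr0.
- exists ('X_j - ((j == k)%:R / a k) *: linform a); split=> [v|].
    by rewrite mevalB mevalZ meval_linform !mevalXU /proj3 -mulrA [_^-1 * _]mulrC.
  by exists ((j == k)%:R / a k)%:MP; rewrite -mul_mpolyC [linform _ * _]mulrC subrK.
- exists (p1' + p2'); split=> [v|]; first by rewrite !mevalD e1 e2.
  by exists (q1 + q2); rewrite {1}d1 {1}d2; ring.
- exists (p1' * p2'); split=> [v|]; first by rewrite !mevalM e1 e2.
  by exists (p1' * q2 + p2' * q1 + linform a * q1 * q2); rewrite {1}d1 {1}d2; ring.
Qed.

(** The projection lands in the plane, so what is left of [p] after eliminating one variable
    vanishes identically. *)
Lemma vanish_plane_dvd a (p : S) : (exists k, a k != 0) -> vanish (plane a) p -> exists q, p = linform a * q.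
Proof.
move=> [k ak] p0; have [p' [e [q d]]] := proj3_mpoly p ak.
exists q; rewrite {1}d; suff -> : p' = 0 by rewrite add0r.
by apply: mpoly_eval0 => v; rewrite e; apply/p0/plane_proj3.
Qed.

(** * Linear algebra in dimension three *)

Section Cross.
Variable K : comPzRingType.
Implicit Types a b u v w : 'I_3 -> K.

(** Over a ring rather than C, because vector fields with polynomial coefficients are multiplied as
    well. *)
Definition cross a b : 'I_3 -> K := fun k =>
  if k == o0 then a o1 * b o2 - a o2 * b o1
  else if k == o1 then a o2 * b o0 - a o0 * b o2
  else a o0 * b o1 - a o1 * b o0.

Lemma ord3_neq : ((o1 == o0) = false) * ((o2 == o0) = false) * ((o2 == o1) = false) * ((o0 == o1) = false) * ((o0 == o2) = false) * ((o1 == o2) = false).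
Proof. by do !split; rewrite -val_eqE /= ?inordK. Qed.

Lemma cross0 a b : cross a b o0 = a o1 * b o2 - a o2 * b o1.
Proof. by rewrite /cross eqxx. Qed.
Lemma cross1 a b : cross a b o1 = a o2 * b o0 - a o0 * b o2.
Proof. by rewrite /cross ord3_neq eqxx. Qed.
Lemma cross2 a b : cross a b o2 = a o0 * b o1 - a o1 * b o0.
Proof. by rewrite /cross !ord3_neq. Qed.
Definition crossE := (cross0, cross1, cross2).
End Cross.

Definition bvec (k : 'I_3) : 'I_3 -> C := fun j => (j == k)%:R.

Lemma dot_bvec a k : dot a (bvec k) = a k.
Proof.
rewrite /dot (bigD1 k) //= big1 => [|j jk]; last by rewrite /bvec (negbTE jk) mulr0.
by rewrite /bvec eqxx mulr1 addr0.
Qed.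

Lemma dotC a b : dot a b = dot b a.
Proof. by apply: eq_bigr => k _; rewrite mulrC. Qed.

Lemma dot_crossl a b : dot a (cross a b) = 0.
Proof. by rewrite /dot big_ord3 !crossE; ring. Qed.

Lemma dot_crossr a b : dot b (cross a b) = 0.
Proof. by rewrite /dot big_ord3 !crossE; ring. Qed.

(** For the equations of two lines: the lines are distinct, and [cross a b] is the point where they
    meet. *)
Definition indep (a b : 'I_3 -> C) := exists k, cross a b k != 0.

Lemma not_indep a b : (exists k, b k != 0) -> ~ indep a b -> exists c, forall k, a k = c * b k.
Proof.
move=> [k bk] nab.
have c0 j : cross a b j = 0 by apply/eqP/negPn/negP => h; apply: nab; exists j.
exists (a k / b k) => j; apply: (mulIf bk).
have -> : a k / b k * b j * b k = a k * b j by rewrite mulrAC divfK // .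
have := (c0 o0, c0 o1, c0 o2); rewrite !crossE => -[[/eqP h0 /eqP h1] /eqP h2].
move: h0 h1 h2; rewrite !subr_eq0 => /eqP h0 /eqP h1 /eqP h2.
by move: k j bk => k j _; move: k j; apply: ord3P; apply: ord3P; rewrite ?h0 ?h1 ?h2 //; rewrite mulrC // mulrC ?h0 ?h1 ?h2.
Qed.

Lemma indep_sym a b : indep a b -> indep b a.
Proof.
move=> [k h]; exists k; move: h; rewrite -oppr_eq0 => h; apply: contra h => /eqP h.
apply/eqP; rewrite -h; elim/ord3P: k {h}; rewrite !crossE; ring.
Qed.

(** The point [cross a (bvec k)] lies on [a], and its product with [b] is minus the [k]-th
    coordinate of [cross a b]. *)
Lemma indep_sep a b : indep a b -> exists2 v, plane a v & dot b v != 0.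
Proof.
move=> [k h]; exists (cross a (bvec k)); first by apply: dot_crossl.
rewrite (_ : dot b _ = - cross a b k) ?oppr_eq0 //.
by elim/ord3P: k {h}; rewrite /dot big_ord3 !crossE /bvec ?eqxx ?ord3_neq /=; ring.
Qed.

(** The expansion [a x (u x w) = u (a . w) - w (a . u)]. *)
Lemma triple_cross a u w k : dot a u = 0 -> dot a w = 0 -> cross a (cross u w) k = 0.
Proof.
rewrite /dot !big_ord3 => hu hw.
have -> : cross a (cross u w) k = u k * (a o0 * w o0 + a o1 * w o1 + a o2 * w o2) - w k * (a o0 * u o0 + a o1 * u o1 + a o2 * u o2).
  by elim/ord3P: k; rewrite !crossE; ring.
by rewrite hu hw; ring.
Qed.

(** Cramer's rule for [v] in the basis [u], [w], [bvec k], whose determinant is [cross u w k]. *)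
Lemma cramer3 u w v k j :
  cross u w k * v j = cross v w k * u j + cross u v k * w j + dot v (cross u w) * (bvec k j).
Proof.
rewrite /dot big_ord3 /bvec.
by elim/ord3P: k; elim/ord3P: j; rewrite !crossE ?eqxx ?ord3_neq /= ?mulr0n ?mulr1n; ring.
Qed.

(** Three vectors of a plane have determinant zero: [cross u w] is a multiple of the normal [a]. *)
Lemma plane_cross a u w v : (exists k, a k != 0) -> plane a u -> plane a w -> plane a v ->
  dot v (cross u w) = 0.
Proof.
move=> [k ak] au aw av.
have t0 := triple_cross _ au aw.
have [||c cE] := @not_indep (cross u w) a; first by exists k.
  move=> /indep_sym [j]; by rewrite t0 eqxx.
rewrite /dot (eq_bigr (fun j => c * (a j * v j))); last by move=> j _; rewrite cE; ring.
by rewrite -mulr_sumr [X in c * X]av mulr0.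
Qed.

Lemma plane_span a u w v : (exists k, a k != 0) -> plane a u -> plane a w -> plane a v -> indep u w ->
  exists s t, forall j, v j = s * u j + t * w j.
Proof.
move=> a0 au aw av [k n0].
exists (cross v w k / cross u w k), (cross u v k / cross u w k) => j.
apply: (mulfI n0); rewrite cramer3 (plane_cross a0 au aw av) mul0r addr0.
by field.
Qed.

Lemma arr_indep d (l : 'I_d -> 'I_3 -> C) i j : line_arrangement l -> i != j -> indep (l i) (l j).
Proof. by move=> [h1 h2] ij; apply: contrapT => /(not_indep (h1 j)); apply: h2. Qed.

Lemma meval_homog k (p : S) c v : p \is k.-homog -> p.@[fun j => c * v j] = c ^+ k * p.@[v].
Proof.
move=> /dhomogP hp; rewrite !mevalE mulr_sumr big_seq [RHS]big_seq; apply: eq_bigr => m mp.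
have -> : k = mdeg m by rewrite -(hp m mp).
rewrite mulrCA; congr (_ * _); rewrite mdegE expr_sum -big_split.
by apply: eq_bigr => i _ /=; rewrite exprMn.
Qed.

(** The parametrised line misses only the point [w] of the projective line; homogeneity takes care
    of multiples and a limit takes care of [w]. *)
Lemma pline0_plane a u w k (p : S) : (exists k, a k != 0) -> plane a u -> plane a w -> indep u w ->
  p \is k.-homog -> pline u w p = 0 -> vanish (plane a) p.
Proof.
move=> a0 au aw iuw hp p0.
have gen s t : s != 0 -> p.@[fun j => s * u j + t * w j] = 0.
  move=> s0; rewrite (_ : p.@[_] = p.@[fun j => s * (addv3 (t / s) u w j)]); last first.
    by apply: meval_eq => j; rewrite /addv3; field.
  by rewrite (meval_homog _ _ hp) -pline_eval p0 horner0 mulr0.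
move=> v av; have [s [t vE]] := plane_span a0 au aw av iuw.
rewrite (meval_eq _ vE); have [->|/gen//] := eqVneq s 0.
(* The missing points, with [s = 0]: along [r |-> t w + r u] the polynomial is zero for nonzero [r],
   so ['X * q = 0] and [q] is zero at [r = 0] as well. *)
pose q := pline (fun j => t * w j) u p.
have : 'X * q = 0.
  apply: poly_eval0 => r; rewrite hornerM hornerX; have [->|r0] := eqVneq r 0; first by rewrite mul0r.
  rewrite pline_eval -[RHS](mulr0 r); congr (_ * _); rewrite -[RHS](gen r t r0).
  by apply: meval_eq => j; rewrite /addv3 addrC.
move/eqP; rewrite mulf_eq0 polyX_eq0 /= => /eqP q0.
have := congr1 (fun z => z.[0]) q0; rewrite horner0 pline_eval => h; rewrite -[RHS]h.
by apply: meval_eq => j; rewrite /addv3 !mul0r addr0 add0r.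
Qed.

Lemma linform_homog a : linform a \is 1.-homog.
Proof. by apply: rpred_sum => k _; apply: rpredZ; rewrite dhomogX /= mdeg1. Qed.

Lemma vanishM W p q : affine_closed W -> ~ vanish W p -> ~ vanish W q -> ~ vanish W (p * q).
Proof. by move=> cW np nq /(vanish_prime cW)/(_ np). Qed.

Lemma vanish_prod (I : eqType) W (r : seq I) (F : I -> S) : affine_closed W -> (exists v, W v) ->
  (forall i, i \in r -> ~ vanish W (F i)) -> ~ vanish W (\prod_(i <- r) F i).
Proof.
move=> cW [v Wv]; elim: r => [_|x r IH h].
  by rewrite big_nil => /(_ v Wv); rewrite meval1 => /eqP; rewrite oner_eq0.
rewrite big_cons; apply: vanishM => //; first by apply/h/mem_head.
by apply: IH => i ir; apply: h; rewrite in_cons ir orbT.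
Qed.

Lemma plane0 a : plane a (fun=> 0).
Proof. by rewrite /plane /dot big1 // => k _; rewrite mulr0. Qed.

Lemma vanish_linform a b : indep a b -> ~ vanish (plane a) (linform b).
Proof. by move=> /indep_sep [v av bv] /(_ v av); rewrite meval_linform => /eqP; rewrite (negbTE bv). Qed.

(** Each new form divides the cofactor, since the product of the previous ones does not vanish on
    its plane and vanishing there is a prime condition. *)
Lemma prod_linform_dvd (I : eqType) (l : I -> 'I_3 -> C) (r : seq I) p : uniq r ->
  (forall i, i \in r -> exists k, l i k != 0) ->
  (forall i j, i != j -> indep (l i) (l j)) ->
  (forall i, i \in r -> vanish (plane (l i)) p) -> exists q, p = (\prod_(i <- r) linform (l i)) * q.
Proof.
move=> + + hl; elim: r => [_ _ _|x r IH /= /andP[xr ur] nz hp].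
  by exists p; rewrite big_nil mul1r.
have [||q qE] := IH ur.
- by move=> i ir; apply: nz; rewrite in_cons ir orbT.
- by move=> i ir; apply: hp; rewrite in_cons ir orbT.
have vq : vanish (plane (l x)) q.
  apply: (vanish_prime (@plane_closed (l x)) (p := \prod_(i <- r) linform (l i))).
    by rewrite -qE; apply/hp/mem_head.
  apply: vanish_prod; [exact: plane_closed|by exists (fun=> 0); apply: plane0|].
  move=> i ir; apply/vanish_linform/hl; by apply: contraNneq xr => ->.
have [q' q'E] := vanish_plane_dvd (nz x (mem_head _ _)) vq.
by exists q'; rewrite big_cons qE q'E; ring.
Qed.

(** * Logarithmic derivations and syzygies *)

Definition vapp (th : 'I_3 -> S) (a : 'I_3 -> C) : S := \sum_k a k *: th k.

(** [vapp th a] is the derivation [th] applied to the form [a]; tangency to a line means that the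
    result is divisible by the equation of the line. *)
Definition logder d (l : 'I_d -> 'I_3 -> C) (th : 'I_3 -> S) :=
  forall i, vanish (plane (l i)) (vapp th (l i)).

Lemma mderiv_linform k a : mderiv k (linform a) = (a k)%:MP.
Proof.
rewrite /linform raddf_sum (bigD1 k) //= big1 => [|j jk]; last first.
  by rewrite mderivZ mderivX mnmE (negbTE jk) scale0r scaler0.
rewrite addr0 mderivZ mderivX mnmE eqxx scale1r (_ : (U_(k) - U_(k))%MM = 0%MM).
  by rewrite mpolyX0 -mul_mpolyC mulr1.
by apply/mnmP => i; rewrite !mnmE subnn.
Qed.

Lemma deriv_prod (I : eqType) (r : seq I) (F : I -> S) k : uniq r ->
  mderiv k (\prod_(i <- r) F i) = \sum_(i <- r) mderiv k (F i) * \prod_(j <- r | j != i) F j.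
Proof.
elim: r => [_|x r IH /= /andP[xr ur]].
  by rewrite !big_nil -mpolyC1 mderivC.
rewrite !big_cons mderivM IH // eqxx /=.
have -> : \prod_(j <- r | j != x) F j = \prod_(j <- r) F j.
  rewrite big_seq_cond [RHS]big_seq; apply: eq_bigl => j.
  by case jr: (j \in r) => //=; apply: contraNneq xr => <-.
congr (_ + _); rewrite mulr_sumr [LHS]big_seq [RHS]big_seq; apply: eq_bigr => i ir.
rewrite big_cons (_ : x != i); last by apply: contraNneq xr => ->.
by rewrite mulrCA.
Qed.

(** The Leibniz rule for the product of the equations. *)
Lemma syz_prod d (l : 'I_d -> 'I_3 -> C) th :
  \sum_k th k * mderiv k (defpoly l) =
  \sum_i vapp th (l i) * \prod_(j | j != i) linform (l j).
Proof.
rewrite /defpoly; under eq_bigr => k _ do rewrite deriv_prod ?index_enum_uniq // mulr_sumr.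
rewrite exchange_big; apply: eq_bigr => i _ /=.
rewrite /vapp mulr_suml; apply: eq_bigr => k _; rewrite mderiv_linform mul_mpolyC.
by rewrite -scalerAr scalerAl.
Qed.

(** On the plane of the line [i] only the [i]-th term of [syz_prod] survives, and the product of the
    other equations does not vanish there. *)
Lemma syz_logder d (l : 'I_d -> 'I_3 -> C) th : line_arrangement l -> is_syz (defpoly l) th -> logder l th.
Proof.
move=> arr; rewrite /is_syz syz_prod => h i.
apply: (vanish_prime (@plane_closed (l i)) (p := \prod_(j | j != i) linform (l j))).
  move=> v lv; move: h; rewrite (bigD1 i) //= mulrC => /(congr1 (meval v)).
  rewrite mevalD meval0 raddf_sum /= [X in _ + X]big1 ?addr0 // => j ji.
  by rewrite mevalM (bigD1 i) 1?eq_sym //= mevalM meval_linform [dot _ _]lv mul0r mulr0.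
rewrite -big_filter; apply: vanish_prod; [exact: plane_closed|by exists (fun=> 0); apply: plane0|].
by move=> j; rewrite mem_filter => /andP[ji _]; apply/vanish_linform/arr_indep; rewrite 1?eq_sym.
Qed.

Definition euler : 'I_3 -> S := fun k => 'X_k.

Lemma vapp_euler a : vapp euler a = linform a. Proof. by []. Qed.

Lemma prodD1_linform d (l : 'I_d -> 'I_3 -> C) i :
  linform (l i) * \prod_(j | j != i) linform (l j) = defpoly l.
Proof. by rewrite [RHS](bigD1 i). Qed.

Lemma syz_euler d (l : 'I_d -> 'I_3 -> C) :
  \sum_k euler k * mderiv k (defpoly l) = d%:R * defpoly l.
Proof.
rewrite syz_prod (eq_bigr (fun=> defpoly l)); last by move=> i _; rewrite vapp_euler prodD1_linform.
by rewrite sumr_const card_ord mulr_natl.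
Qed.

(* If th(l_i) = g_i l_i, then th f = (sum_i g_i) f = th' f for th' = (sum_i g_i / d) euler. *)
Lemma logder_decomp d (l : 'I_d -> 'I_3 -> C) th : (0 < d)%N -> line_arrangement l -> logder l th ->
  exists g, is_syz (defpoly l) (fun k => th k - g * euler k).
Proof.
move=> d0 [nz _] lth.
have /choice [g gE] : forall i, exists g, vapp th (l i) = linform (l i) * g.
  by move=> i; apply/vanish_plane_dvd => //; apply: lth.
exists (\sum_i g i * (d%:R^-1)%:MP); rewrite /is_syz.
under eq_bigr => k _ do rewrite mulrBl -mulrA.
rewrite sumrB -mulr_sumr syz_euler syz_prod.
rewrite (eq_bigr (fun i => g i * defpoly l)); last first.
  by move=> i _; rewrite gE -(prodD1_linform l i); ring.
rewrite -!mulr_suml mulrA -[_ * _ * d%:R]mulrA -mpolyC_nat -mpolyCM mulVf ?pnatr_eq0 -?lt0n //.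
by rewrite mpolyC1 mulr1 subrr.
Qed.

(** * Logarithmic derivations in large degree *)

Lemma size_lin (a b : C) : (size (a%:P + b *: 'X)%R <= 2)%N.
Proof.
rewrite (leq_trans (size_polyD _ _)) // geq_max size_polyC (leq_trans (leq_b1 _)) //=.
by rewrite (leq_trans (size_scale_leq _ _)) // size_polyX.
Qed.

Lemma size_pline u w k (p : S) : p \is k.-homog -> (size (pline u w p) <= k.+1)%N.
Proof.
move=> /dhomogP hp; rewrite /pline /mmap big_seq.
apply: (leq_trans (size_sum _ _ _)); apply/bigmax_leqP_seq => m _ mp.
rewrite mul_polyC (leq_trans (size_scale_leq _ _)) //.
have -> : k = mdeg m by rewrite -(hp m mp).
rewrite mdegE /mmap1; apply: (big_ind2 (fun (p : {poly C}) n => (size p <= n.+1)%N)).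
- by rewrite size_poly1.
- move=> p1 n1 p2 n2 h1 h2; rewrite (leq_trans (size_polyMleq _ _)) //.
  by lia.
- move=> i _; rewrite (leq_trans (size_poly_exp_leq _ _)) // ltnS.
  by have := size_lin (u i) (w i); nia.
Qed.

Lemma pline_linform u w a : pline u w (linform a) = (dot a u)%:P + (dot a w) *: 'X.
Proof.
rewrite /linform raddf_sum /= (eq_bigr (fun i => (a i * u i)%:P + (a i * w i) *: 'X)).
  by rewrite big_split /= -raddf_sum /dot scaler_suml.
by move=> i _; rewrite plineZ plineX scalerDr scalerA -!mul_polyC -polyCM.
Qed.

Lemma pline_lift u w k (psi : {poly C}) : indep u w -> (size psi <= k.+1)%N ->
  exists2 p : S, p \is k.-homog & pline u w p = psi.
Proof.
move=> [j nj] hs.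
(* [al] and [be] are the coordinates dual to [u] and [w], by Cramer's rule with [bvec j] as third
   vector. They restrict to [1] and ['X], so a polynomial is lifted by homogenising it in them. *)
pose al := linform (fun i => (cross u w j)^-1 * cross w (bvec j) i).
pose be := linform (fun i => (cross u w j)^-1 * cross (bvec j) u i).
have dz (c : C) a b : dot (fun i => c * a i) b = c * dot a b.
  by rewrite /dot mulr_sumr; apply: eq_bigr => i _; rewrite mulrA.
have hal : pline u w al = 1.
  rewrite pline_linform !dz (dotC _ w) dot_crossl mulr0 scale0r addr0.
  rewrite (_ : dot _ u = cross u w j) ?mulVf // /dot big_ord3 /bvec.
  by elim/ord3P: j {nj al be}; rewrite !crossE ?eqxx ?ord3_neq /= ?mulr0n ?mulr1n; ring.
have hbe : pline u w be = 'X.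
  rewrite pline_linform !dz (dotC _ u) dot_crossr mulr0 polyC0 add0r.
  rewrite (_ : dot _ w = cross u w j) ?mulVf ?scale1r // /dot big_ord3 /bvec.
  by elim/ord3P: j {nj al be hal}; rewrite !crossE ?eqxx ?ord3_neq /= ?mulr0n ?mulr1n; ring.
exists (\sum_(m < k.+1) psi`_m *: (al ^+ (k - m) * be ^+ m)).
  apply: rpred_sum => m _; apply: rpredZ.
  have kE : (1 * (k - m) + 1 * m = k)%N by have := ltn_ord m; lia.
  have : al ^+ (k - m) * be ^+ m \is (1 * (k - m) + 1 * m).-homog.
    by apply: dhomogM; apply/dhomogMn/linform_homog.
  by rewrite kE.
rewrite raddf_sum /= (eq_bigr (fun m : 'I_k.+1 => psi`_m *: 'X^m)); last first.
  by move=> m _; rewrite plineZ rmorphM !rmorphXn /= hal hbe expr1n mul1r.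
rewrite -(poly_def _ (fun i => psi`_i)); apply/polyP => i; rewrite coef_poly.
by case: ltnP => // hi; rewrite nth_default // (leq_trans hs).
Qed.

(** Lagrange interpolation with polynomial weights. Subtracting the multiple of the product over the
    other nodes that corrects the value at [x] leaves a multiple of ['X - x], to which induction
    applies. *)
Lemma lagrange_decomp (rs : seq C) M (q : {poly C}) : uniq rs -> rs != [::] -> (0 < M)%N ->
  (size q <= M + (size rs).-1)%N ->
  exists psi : C -> {poly C}, (forall x, size (psi x) <= M)%N /\
    q = \sum_(x <- rs) (\prod_(y <- rs | y != x) ('X - y%:P)) * psi x.
Proof.
move=> + + M0; elim: rs q => [//|x rs IH] q /= /andP[xrs urs] _ hs.
have [rs0|rsN] := eqVneq rs [::].
  move: hs; rewrite rs0 addn0 => hs; exists (fun=> q); split=> //.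
  by rewrite big_seq1 big_cons big_nil eqxx mul1r.
pose P := \prod_(y <- rs) ('X - y%:P).
have Px : P.[x] != 0.
  by rewrite -[_ == 0]/(root P x) root_prod_XsubC.
pose c := q.[x] / P.[x].
have /factor_theorem [q' q'E] : root (q - c *: P) x.
  by rewrite rootE hornerD hornerN hornerZ /c divfK ?subrr.
have hq' : (size q' <= M + (size rs).-1)%N.
  have : (size (q - c *: P)%R <= M + size rs)%N.
    rewrite (leq_trans (size_polyD _ _)) // geq_max hs size_polyN.
    by rewrite (leq_trans (size_scale_leq _ _)) // size_prod_XsubC; lia.
  have s0 : (0 < size rs)%N by case: (rs) rsN.
  have [->|q'0] := eqVneq q' 0; first by rewrite size_poly0.
  by rewrite q'E size_Mmonic ?monicXsubC // size_XsubC addn2 /=; case: (size rs) s0 => [//|b] _; rewrite addnS ltnS.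
have [psi [hpsi q'D]] := IH q' urs rsN hq'.
exists (fun y => if y == x then c%:P else psi y); split.
  by move=> y; case: ifP => // _; rewrite size_polyC (leq_trans (leq_b1 _)).
rewrite big_cons eqxx big_cons eqxx /=.
have -> : \prod_(y <- rs | y != x) ('X - y%:P) = P.
  rewrite big_seq_cond /P [RHS]big_seq; apply: eq_bigl => y.
  by case yr: (y \in rs) => //=; apply: contraNneq xrs => <-.
rewrite mulrC mul_polyC -[LHS](subrK (c *: P)) q'E q'D addrC; congr (_ + _).
rewrite mulr_suml big_seq [RHS]big_seq; apply: eq_bigr => y yr.
have yx : y != x by apply: contraNneq xrs => <-.
by rewrite (negbTE yx) big_cons eq_sym yx mulrC mulrA.
Qed.

Notation vfield k := {ffun 'I_3 -> dhomog 3 C k}.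

Definition vf k (th : vfield k) : 'I_3 -> S := fun c => mpoly_of_dhomog (th c).

Lemma vapp_lin k (t1 t2 : vfield k) (c : C) a :
  vapp (vf (c *: t1 + t2)) a = c *: vapp (vf t1) a + vapp (vf t2) a.
Proof.
rewrite /vapp scaler_sumr -big_split; apply: eq_bigr => i _ /=.
have -> : vf (c *: t1 + t2) i = c *: vf t1 i + vf t2 i by rewrite /vf !ffunE.
by rewrite scalerDr !scalerA mulrC.
Qed.

Lemma vapp_homog k (th : vfield k) a : vapp (vf th) a \is k.-homog.
Proof. by apply: rpred_sum => i _; apply/rpredZ/dhomog_is_dhomog. Qed.

(** The obstruction to tangency: [th(a)] restricted to the line through [u] and [w]. Values lie in a
    space of polynomials of bounded size, so that rank-nullity applies. *)
Definition resl a u w k (th : vfield k) : {poly_(k.+1) C} := npolyp k.+1 (pline u w (vapp (vf th) a)).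

Lemma reslE a u w k th : @resl a u w k th = pline u w (vapp (vf th) a) :> {poly C}.
Proof. by rewrite npolypK // size_pline // vapp_homog. Qed.

Lemma resl_linear a u w k : linear (@resl a u w k).
Proof.
move=> c t1 t2; apply/val_inj; rewrite [LHS]reslE vapp_lin raddfD /= plineZ.
by rewrite !npolypK ?size_pline ?vapp_homog.
Qed.

HB.instance Definition _ a u w k :=
  GRing.isLinear.Build C (vfield k) {poly_(k.+1) C} _ (@resl a u w k) (@resl_linear a u w k).

Definition mulnp (G : {poly C}) m n (q : {poly_m C}) : {poly_n C} := npolyp n (G * q).

Lemma mulnp_linear (G : {poly C}) m n : (size G + m <= n.+1)%N -> linear (@mulnp G m n).
Proof.
move=> h.
have hs (q : {poly_m C}) : (size (G * q)%R <= n)%N.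
  by rewrite (leq_trans (size_polyMleq _ _)) //; have := size_npoly q; lia.
by move=> c q1 q2; apply/val_inj; rewrite /= !npolypK ?hs //= mulrDr scalerAr.
Qed.

(** Multiplication by [G] maps the polynomials of size at most [m] isomorphically onto [U]. *)
Lemma dim_multiples (G : {poly C}) m n (U : {vspace {poly_n C}}) : G != 0 -> (size G + m = n.+1)%N ->
  (forall q : {poly_n C}, q \in U <-> exists r : {poly C}, (q : {poly C}) = G * r) -> \dim U = m.
Proof.
move=> G0 h hU.
have h' : (size G + m <= n.+1)%N by rewrite h.
have gL := GRing.isLinear.Build C {poly_m C} {poly_n C} _ (@mulnp G m n) (mulnp_linear h').
pose f : {linear {poly_m C} -> {poly_n C}} := HB.pack (@mulnp G m n) gL.
have fE (q : {poly_m C}) : f q = G * q :> {poly C}.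
  rewrite npolypK // (leq_trans (size_polyMleq _ _)) //; have := size_npoly q; lia.
have -> : U = limg (linfun f).
  apply/vspaceP => q; apply/idP/memv_imgP => [/hU [r qE]|[r _ ->]].
    have sr : (size r <= m)%N.
      have [->|r0] := eqVneq r 0; first by rewrite size_poly0.
      have := size_npoly q; rewrite qE size_mul //.
      have : (0 < size r)%N by rewrite size_poly_gt0.
      by move: h; clear; move: (size r) (size G) => a b; lia.
    exists (npolyp m r); first by rewrite memvf.
    by rewrite lfunE; apply/val_inj; rewrite [RHS]fE npolypK.
  by apply/hU; exists r; rewrite lfunE fE.
rewrite limg_dim_eq ?dim_polyn //; apply/eqP; rewrite capfv; apply/lker0P => q1 q2.
by rewrite !lfunE => /(congr1 val); rewrite /= !fE => /(mulfI G0) ?; apply/val_inj.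
Qed.

Lemma dim_vfield k : \dim (fullv : {vspace vfield k}) = (3 * 'C(k + 2, k))%N.
Proof. by rewrite dimvf /dim /= card_ord. Qed.

(** Concurrency as a vanishing determinant: [cross (l i) (l j)] is the common point of two distinct
    lines [i] and [j]. *)
Definition conc d (l : 'I_d -> 'I_3 -> C) i j m := dot (l m) (cross (l i) (l j)) == 0.

Lemma plane_basis a (nz : exists k, a k != 0) : exists b, indep a b.
Proof.
case: nz => k ak; pose j := if k == o0 then o1 else o0.
have jk : j != k by rewrite /j; case: (eqVneq k o0) => [->|]; rewrite ?ord3_neq // eq_sym.
exists (bvec j); apply: contrapT => h.
have [c cE] : exists c, forall i, bvec j i = c * a i.
  apply: not_indep; first by exists k.
  by move/indep_sym.
have := cE k; rewrite /bvec eq_sym (negbTE jk) => /esym/eqP.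
rewrite mulf_eq0 (negbTE ak) orbF => /eqP c0.
by have /eqP := cE j; rewrite /bvec eqxx c0 mul0r oner_eq0.
Qed.

Section Step.
Variables (d : nat) (l : 'I_d -> 'I_3 -> C).
Hypothesis arr : line_arrangement l.

(** [w] is the point at infinity of the parametrisation [u + t w]; keeping it off the other lines
    gives every intersection point a finite parameter. *)
Lemma generic_basis n : exists u w, [/\ plane (l n) u, plane (l n) w, indep u w &
   forall i, i != n -> dot (l i) w != 0].
Proof.
have [b ib] := plane_basis (arr.1 n).
(* The factor [linform b] only ensures that [w] is nonzero. *)
have np : ~ vanish (plane (l n)) (linform b * \prod_(i | i != n) linform (l i)).
  apply: vanishM; [exact: plane_closed|exact: vanish_linform|].
  rewrite -big_filter; apply: vanish_prod; [exact: plane_closed|by exists (fun=> 0); apply: plane0|].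
  by move=> j; rewrite mem_filter => /andP[ji _]; apply/vanish_linform/(arr_indep arr); rewrite eq_sym.
have [w wl] : exists w, ~ (plane (l n) w -> (linform b * \prod_(i | i != n) linform (l i)).@[w] = 0).
  by apply: contrapT => /forallNP h; apply: np => w; apply: contrapT => /h.
move/not_implyP: wl => [wl]; rewrite mevalM rmorph_prod meval_linform => /eqP.
rewrite mulf_eq0 negb_or => /andP[bw /prodf_neq0 hw].
have [j wj] : exists j, w j != 0.
  apply: contrapT => /forallNP h; move: bw; rewrite /dot big1 ?eqxx // => j _.
  by have /negP/negPn/eqP -> := h j; rewrite mulr0.
have [m am] := arr.1 n.
(* For [w] on the line [n], the cross product of this point with [w] is [- w j] times [l n], and
   [w j] is nonzero. *)
exists (cross (l n) (bvec j)), w; split=> //; first by apply: dot_crossl.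
  exists m; rewrite (_ : cross _ w m = - (l n m * w j)) ?oppr_eq0 ?mulf_neq0 //.
  rewrite -[RHS]add0r -(mulr0 (bvec j m)) -[in RHS]wl /dot big_ord3 /bvec.
  by elim/ord3P: m {am}; elim/ord3P: j {wj}; rewrite !crossE ?eqxx ?ord3_neq /= ?mulr0n ?mulr1n; ring.
by move=> i ni; have := hw i ni; rewrite /= meval_linform.
Qed.

Variables (n : 'I_d) (u w : 'I_3 -> C).
Hypotheses (pu : plane (l n) u) (pw : plane (l n) w) (iuw : indep u w).
Hypothesis (hw : forall i, i != n -> dot (l i) w != 0).

(* Parameter on [t |-> u + t w] of the intersection with the line [i]. *)
Definition rt i := - dot (l i) u / dot (l i) w.

Lemma pline_rt i : i != n -> pline u w (linform (l i)) = dot (l i) w *: ('X - (rt i)%:P).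
Proof.
move=> /hw ni; rewrite pline_linform addrC scalerBr; congr (_ + _).
by rewrite -mul_polyC -polyCM -polyCN; congr (_%:P); rewrite /rt; field.
Qed.

Lemma rt_point i : i != n -> dot (l i) (addv3 (rt i) u w) = 0.
Proof. by move=> /hw ni; rewrite dot_addv3 /rt divfK // subrr. Qed.

Lemma rt_plane x : plane (l n) (addv3 x u w).
Proof. by rewrite /plane dot_addv3 pu pw mulr0 addr0. Qed.

Lemma rt_neq0 x : exists k, addv3 x u w k != 0.
Proof.
apply: contrapT => /forallNP h; have [k /eqP] := iuw; apply.
have h' j : u j = - (x * w j) by apply/eqP; rewrite -addr_eq0; apply/negPn/negP/h.
by elim/ord3P: k; rewrite !crossE !h'; ring.
Qed.

Lemma rt_conc i j : i != n -> j != n -> i != j -> (rt i == rt j) = conc l i j n.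
Proof.
move=> ni nj ij; apply/eqP/eqP => [e|].
  apply: (plane_cross (rt_neq0 (rt i))); rewrite /plane dotC ?rt_point ?rt_plane //.
  by rewrite e rt_point.
move=> c0; have [s [t pE]] := plane_span (arr.1 n) pu pw c0 iuw.
have dp a : dot a (cross (l i) (l j)) = s * dot a u + t * dot a w.
  by rewrite /dot !mulr_sumr -big_split; apply: eq_bigr => k _ /=; rewrite pE; ring.
have ti : t = s * rt i.
  apply: (mulIf (hw ni)); rewrite -mulrA /rt divfK ?hw //; apply/eqP.
  by rewrite mulrN -addr_eq0 addrC -dp dot_crossl.
have tj : t = s * rt j.
  apply: (mulIf (hw nj)); rewrite -mulrA /rt divfK ?hw //; apply/eqP.
  by rewrite mulrN -addr_eq0 addrC -dp dot_crossr.
have s0 : s != 0.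
  apply/eqP => s0; have [k] := arr_indep arr ij; rewrite pE ti s0 !mul0r addr0 eqxx //.
by apply: (mulfI s0); rewrite -ti.
Qed.
End Step.

(** The constant direction [v] with coefficient [g]. The default of [insubd] is harmless, as [g] is
    homogeneous of degree [k] wherever this is used. *)
Definition mkf k (g : S) (v : 'I_3 -> C) : vfield k := [ffun c => insubd (0 : dhomog 3 C k) (v c *: g)].

Lemma vf_mkf k (g : S) v c : g \is k.-homog -> vf (mkf k g v) c = v c *: g.
Proof. by move=> hg; rewrite /vf ffunE val_insubd rpredZ. Qed.

Lemma vapp_mkf k (g : S) v a : g \is k.-homog -> vapp (vf (mkf k g v)) a = dot a v *: g.
Proof. by move=> hg; rewrite /vapp /dot scaler_suml; apply: eq_bigr => c _; rewrite vf_mkf // scalerA. Qed.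

Section StepDim.
Variables (d : nat) (l : 'I_d -> 'I_3 -> C).
Hypothesis arr : line_arrangement l.
Hypothesis no4 : forall i1 i2 i3 n, uniq [:: i1; i2; i3; n] -> conc l i1 i2 n -> conc l i1 i3 n -> False.
Variables (n : 'I_d) (u w : 'I_3 -> C).
Hypotheses (pu : plane (l n) u) (pw : plane (l n) w) (iuw : indep u w).
Hypothesis (hw : forall i, i != n -> dot (l i) w != 0).
Variables (k : nat) (U : {vspace vfield k}).
Hypothesis nk : (n <= k)%N.
Hypothesis hU : forall th : vfield k, th \in U <-> (forall i : 'I_d, (i < n)%N -> vanish (plane (l i)) (vapp (vf th) (l i))).

(* On the line [m], the line [i] is not the first one through its point. *)
Definition sec (m i : 'I_d) := [exists i' : 'I_d, (i' < i)%N && conc l i' i m].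

Local Notation rt := (rt l u w).
Local Notation ev := (linfun (@resl (l n) u w k)).

Let ltn_neq (i : 'I_d) : (i < n)%N -> i != n.
Proof. by move=> h; apply: contraTneq h => ->; rewrite ltnn. Qed.

(** Multiplicity at most three: at most two earlier lines pass through a point of the line [n], so
    the classes of first and of second lines have at most one member each there. *)
Lemma rt_inj_class b (i j : 'I_d) : (i < n)%N -> (j < n)%N -> sec n i = b -> sec n j = b -> rt i = rt j -> i = j.
Proof.
wlog ij : i j / (i < j)%N => [hwlog ni nj si sj e|ni nj si sj e].
  case: (ltngtP i j) => [h|h|/val_inj//]; first exact: hwlog.
  by apply/esym/hwlog.
have nij : i != j by apply: contraTneq ij => ->; rewrite ltnn.
have cij : conc l i j n.
  by rewrite -(rt_conc arr pu pw iuw hw (ltn_neq ni) (ltn_neq nj) nij) e.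
have sj' : sec n j by apply/existsP; exists i; rewrite ij.
case: b si sj => si sj; last by move: sj; rewrite sj'.
case/existsP: si => i' /andP[ii' c'].
have nii' : i' != i by apply: contraTneq ii' => ->; rewrite ltnn.
have ni' : (i' < n)%N by apply: ltn_trans ni.
have nij' : i' != j by apply: contraTneq (ltn_trans ii' ij) => ->; rewrite ltnn.
have e' : rt i' = rt i by apply/eqP; rewrite (rt_conc arr pu pw iuw hw (ltn_neq ni') (ltn_neq ni) nii').
exfalso; apply: (no4 (i1 := i') (i2 := i) (i3 := j) (n := n)) => //.
  by rewrite /= !inE !negb_or nii' nij' nij !ltn_neq.
by rewrite -(rt_conc arr pu pw iuw hw (ltn_neq ni') (ltn_neq nj) nij') e' e.
Qed.

(** [cls false] has one line for each point where [n] meets earlier lines, [cls true] one for each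
    triple point that [n] completes. *)
Definition cls b : seq 'I_d := [seq i : 'I_d <- enum 'I_d | (i < n)%N && (sec n i == b)].
Definition Gp b := \prod_(i <- cls b) ('X - (rt i)%:P).

Lemma mem_cls b (i : 'I_d) : (i \in cls b) = (i < n)%N && (sec n i == b).
Proof. by rewrite mem_filter mem_enum andbT. Qed.

Lemma uniq_cls b : uniq [seq rt i | i <- cls b].
Proof.
rewrite map_inj_in_uniq => [|i j]; first exact: filter_uniq (enum_uniq _).
by rewrite !mem_cls => /andP[ni /eqP si] /andP[nj /eqP sj]; apply: rt_inj_class si sj.
Qed.

Lemma size_cls : (size (cls true) + size (cls false) = n)%N.
Proof.
have -> : n = size [seq i : 'I_d <- enum 'I_d | (i < n)%N] :> nat.
  transitivity (size [seq i <- map val (enum 'I_d) | (i < n)%N]).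
    by rewrite val_enum_ord (@filter_iota_ltn 0 d n) ?size_iota // ltnW.
  by rewrite filter_map size_map.
rewrite /cls !size_filter.
elim: (enum 'I_d) => //= i s <-; case: (i < n)%N; case: (sec n i) => /=; clear; lia.
Qed.


(** At a triple point completed by [n], the form [l n] is a combination of the two earlier forms,
    hence [th(l n)] vanishes there together with theirs. *)
Lemma cls_vanish (th : vfield k) : th \in U -> Gp true %| (resl (l n) u w th : {poly C}).
Proof.
move/hU => hth; rewrite /Gp -(big_map rt xpredT (fun z => 'X - z%:P)); apply: uniq_roots_dvdp; last first.
  by rewrite uniq_rootsE uniq_cls.
apply/allP => _ /mapP[i + ->]; rewrite mem_cls => /andP[ni /eqP/existsP[i' /andP[ii' c']]].
have ni' : (i' < n)%N by apply: ltn_trans ni.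
have nii' : i' != i by apply: contraTneq ii' => ->; rewrite ltnn.
have e' : rt i' = rt i by apply/eqP; rewrite (rt_conc arr pu pw iuw hw (ltn_neq ni') (ltn_neq ni) nii').
pose v := addv3 (rt i) u w; pose tau c := (vf th c).@[v].
have vE a : (vapp (vf th) a).@[v] = dot a tau.
  by rewrite /vapp raddf_sum; apply: eq_bigr => c _; rewrite /= mevalZ.
have vi : plane (l i) v by apply/rt_point/ltn_neq.
have vi' : plane (l i') v by rewrite /v -e'; apply/rt_point/ltn_neq.
have [s [t lE]] : exists s t, forall j, l n j = s * l i' j + t * l i j.
  apply: (@plane_span v); rewrite /plane 1?dotC //; [exact: (rt_neq0 iuw)|exact: (rt_plane pu pw)|exact: arr_indep].
rewrite rootE reslE pline_eval vE.
rewrite (_ : dot _ tau = s * dot (l i') tau + t * dot (l i) tau); last first.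
  by rewrite /dot !mulr_sumr -big_split; apply: eq_bigr => j _ /=; rewrite lE; ring.
by rewrite -!vE (hth i') // (hth i) // !mulr0 addr0.
Qed.

Lemma pline_prodlin (s : seq 'I_d) : (forall i, i \in s -> i != n) ->
  exists2 c, c != 0 & pline u w (\prod_(i <- s) linform (l i)) = c *: \prod_(i <- s) ('X - (rt i)%:P).
Proof.
elim: s => [_|i s IH hs].
  by exists 1; rewrite ?oner_eq0 // !big_nil rmorph1 scale1r.
have [|c c0 cE] := IH; first by move=> j js; apply: (hs j); rewrite in_cons js orbT.
exists (dot (l i) w * c); first by rewrite mulf_neq0 // hw // hs // mem_head.
rewrite !big_cons rmorphM /= cE (pline_rt _ hw) ?hs ?mem_head //.
by rewrite -scalerAl -scalerAr scalerA.
Qed.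

Lemma homog_prodlin (s : seq 'I_d) : \prod_(i <- s) linform (l i) \is (size s).-homog.
Proof.
elim: s => [|i s IH]; first by rewrite big_nil dhomog1.
rewrite big_cons /=; exact: dhomogM (linform_homog _) IH.
Qed.

(** The witness is the product of the equations in [s], times a lift of [psi], in the direction [q].
    The product makes it tangent to the lines of [s], and the other earlier lines contain [q]; as
    [n] does not contain [q], its restriction can be normalised to [r]. *)
Lemma img_elt (s : seq 'I_d) (q : 'I_3 -> C) (psi : {poly C}) (r : {poly_(k.+1) C}) :
  (forall i, i \in s -> (i < n)%N) -> dot (l n) q != 0 ->
  (forall i : 'I_d, (i < n)%N -> i \notin s -> dot (l i) q = 0) ->
  (size s <= k)%N -> (size psi <= (k - size s).+1)%N ->
  (r : {poly C}) = (\prod_(i <- s) ('X - (rt i)%:P)) * psi -> r \in (ev @: U)%VS.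
Proof.
move=> hs nq hq sk spsi rE.
have [|c c0 cE] := @pline_prodlin s; first by move=> i /hs /ltn_neq.
have [p hp pE] := pline_lift iuw spsi.
pose g := (dot (l n) q * c)^-1 *: (\prod_(i <- s) linform (l i) * p).
have hg : g \is k.-homog.
  by apply: rpredZ; have := dhomogM (homog_prodlin s) hp; rewrite subnKC.
have th : mkf k g q \in U.
  apply/hU => i ni v lv; rewrite vapp_mkf // mevalZ.
  have [si|si] := boolP (i \in s); last by rewrite hq // mul0r.
  by rewrite mevalZ mevalM (big_rem i si) /= mevalM meval_linform [dot _ v]lv !(mul0r, mulr0).
apply/memv_imgP; exists (mkf k g q) => //.
rewrite lfunE; apply/val_inj; rewrite [RHS]reslE vapp_mkf // plineZ plineZ rmorphM /= cE pE.
by rewrite [LHS]rE -scalerAl !scalerA invfM mulrA mulfV ?mul1r ?mulVf ?scale1r.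
Qed.

Lemma rt_prod_split (i : 'I_d) : i \in cls false ->
  \prod_(j <- rem i (cls true ++ cls false)) ('X - (rt j)%:P) =
  Gp true * \prod_(y <- [seq rt j | j <- cls false] | y != rt i) ('X - y%:P).
Proof.
move=> ic; have ni : i \notin cls true.
  by move: ic; rewrite !mem_cls => /andP[-> /eqP ->].
have XN : 'X - (rt i)%:P != 0 by apply/monic_neq0/monicXsubC.
apply: (mulfI XN).
have <- : \prod_(j <- cls true ++ cls false) ('X - (rt j)%:P) =
    ('X - (rt i)%:P) * \prod_(j <- rem i (cls true ++ cls false)) ('X - (rt j)%:P).
  by rewrite (big_rem i) // mem_cat ic orbT.
rewrite big_cat /= mulrCA; congr (_ * _).
rewrite -(big_map rt xpredT (fun y => 'X - y%:P)) (bigD1_seq (rt i)) ?uniq_cls //.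
by apply: map_f.
Qed.

(* The restrictions to the line [n] are the multiples of the product [Gp true] of
   the linear factors of the triple points: each is hit because, for [q] on the
   line [i], the field (product of the other equations) * d/dq is tangent to all. *)
Lemma step_dim : \dim (ev @: U)%VS = (k.+1 - size (cls true))%N.
Proof.
have sc := size_cls.
apply: (@dim_multiples (Gp true)).
- by apply/monic_neq0; rewrite /Gp; apply: monic_prod_XsubC.
- by rewrite /Gp size_prod_XsubC; lia.
move=> q; split.
  move/memv_imgP => [th /cls_vanish h ->]; rewrite lfunE.
  by move/dvdpP: h => [r ->]; exists r; rewrite mulrC.
move=> [r qE].
(* [cls false] is empty only for the first line; there a form of degree [k] in a constant direction
   off the line reaches every [q]. *)
have [c0|cN] := eqVneq (cls false) [::].
  have n0 : n = 0%N :> nat.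
    apply/eqP; rewrite -leqn0 leqNgt; apply/negP => n0.
    have d0 : (0 < d)%N by apply: leq_trans (ltn_ord n).
    have : Ordinal d0 \in cls false.
      by rewrite mem_cls n0 /= eqbF_neg; apply/existsPn => i'; rewrite ltn0.
    by rewrite c0.
  have [k0 nk0] := arr.1 n.
  apply: (@img_elt [::] (bvec k0) q) => //; rewrite ?dot_bvec ?big_nil ?mul1r //.
    by move=> i; rewrite n0.
  by rewrite subn0 size_npoly.
have sN : (0 < size (cls false))%N by case: (cls false) cN.
(* [(k - n).+2] is the size of a polynomial of degree [k - (n - 1)]: what a product of [n - 1]
   equations leaves of the degree [k]. *)
have hr : (size r <= (k - n).+2 + (size [seq rt i | i <- cls false]).-1)%N.
  rewrite size_map; have [->|r0] := eqVneq r 0; first by rewrite size_poly0.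
  have := size_npoly q; rewrite qE size_mul //; last first.
    by apply/monic_neq0; rewrite /Gp; apply: monic_prod_XsubC.
  move: r0 sc sN nk; rewrite -size_poly_gt0 /Gp size_prod_XsubC; clear.
  by move: (size r) (size (cls true)) (size (cls false)) (nat_of_ord n) => a b c e; lia.
have rsN : [seq rt i | i <- cls false] != [::] by case: (cls false) cN.
have [psi [hpsi rE]] := @lagrange_decomp _ (k - n).+2 r (uniq_cls false) rsN isT hr.
pose T i := \prod_(j <- rem i (cls true ++ cls false)) ('X - (rt j)%:P) * psi (rt i).
have szr i : i \in cls false -> size (rem i (cls true ++ cls false)) = n.-1.
  by move=> ic; rewrite size_rem ?mem_cat ?ic ?orbT // size_cat sc.
have n0 : (0 < n)%N by lia.
have hT i : i \in cls false -> (size (T i) <= k.+1)%N.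
  move=> ic; rewrite (leq_trans (size_polyMleq _ _)) // size_prod_XsubC szr //.
  move: (hpsi (rt i)) n0 nk; clear.
  by move: (size (psi (rt i))) (nat_of_ord n) => a b; lia.
have -> : q = \sum_(i <- cls false) npolyp k.+1 (T i).
  apply/val_inj; rewrite [LHS]qE raddf_sum /= [RHS]big_seq rE big_map mulr_sumr big_seq.
  by apply: eq_bigr => i ic; rewrite npolypK ?hT // /T rt_prod_split // mulrA.
rewrite big_seq; apply: memv_suml => i ic.
have ni : (i < n)%N by move: ic; rewrite mem_cls => /andP[].
have ri j : j \in rem i (cls true ++ cls false) = [&& (j < n)%N & j != i].
  rewrite (mem_rem_uniq); last first.
    rewrite cat_uniq; apply/and3P; split; [exact: filter_uniq (enum_uniq _)| |exact: filter_uniq (enum_uniq _)].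
    by apply/hasPn => z; rewrite !mem_cls => /andP[-> /eqP ->].
  by rewrite inE mem_cat !mem_cls andbC /=; case: (j < n)%N => //=; case: (sec n j).
have [qv pq nq] := indep_sep (arr_indep arr (ltn_neq ni)).
apply: (@img_elt (rem i (cls true ++ cls false)) qv (psi (rt i))) => //.
- by move=> j; rewrite ri => /andP[].
- by move=> j jn; rewrite ri jn /= negbK => /eqP ->.
- by rewrite szr //; lia.
- by rewrite szr // (leq_trans (hpsi _)) //; lia.
- by rewrite npolypK // hT.
Qed.


End StepDim.

(** * Intersection points of the lines *)

Section Combinatorics.
Variables (d : nat) (l : 'I_d -> 'I_3 -> C).
Hypothesis arr : line_arrangement l.

Lemma concC (i j m : 'I_d) : conc l i j m = conc l j i m.
Proof.
rewrite /conc (_ : dot (l m) (cross (l i) (l j)) = - dot (l m) (cross (l j) (l i))) ?oppr_eq0 //.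
by rewrite /dot !big_ord3 !crossE; ring.
Qed.

Lemma concCA (i j m : 'I_d) : conc l i j m = conc l i m j.
Proof.
rewrite /conc (_ : dot (l m) (cross (l i) (l j)) = - dot (l j) (cross (l i) (l m))) ?oppr_eq0 //.
by rewrite /dot !big_ord3 !crossE; ring.
Qed.

(** The intersection point of two lines in the encoding of [nmult], as the set of lines through
    it. *)
Definition meetset i j : {set 'I_d} := [set m | conc l i j m].

Lemma meetset_l i j : i \in meetset i j.
Proof. by rewrite inE /conc dot_crossl. Qed.

Lemma meetset_r i j : j \in meetset i j.
Proof. by rewrite inE /conc dot_crossr. Qed.

Lemma meetset_exact i j : i != j -> exact_point_set l (meetset i j).
Proof.
move=> ij; exists (cross (l i) (l j)); split; first exact: (arr_indep arr ij).
by move=> m; rewrite inE.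
Qed.

(** Two lines determine their common point; and if [m] passes through it, [l m] is a combination of
    [l i] and [l j]. *)
Lemma exact_meetset B i j : exact_point_set l B -> i \in B -> j \in B -> i != j -> B = meetset i j.
Proof.
move=> [v [v0 hB]] iB jB ij.
have vi : dot (l i) v = 0 by have := hB i; rewrite iB => /eqP.
have vj : dot (l j) v = 0 by have := hB j; rewrite jB => /eqP.
apply/setP => m; rewrite inE -hB /on_line -/(dot (l m) v); apply/eqP/eqP => h.
  by apply: (plane_cross v0); rewrite /plane dotC.
have iij := arr_indep arr ij.
have [s [t lE]] : exists s t, forall k, l m k = s * l i k + t * l j k.
  apply: (@plane_span (cross (l i) (l j))) => //; rewrite /plane dotC ?dot_crossl ?dot_crossr //.
rewrite (_ : dot (l m) v = s * dot (l i) v + t * dot (l j) v); last first.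
  by rewrite /dot !mulr_sumr -big_split; apply: eq_bigr => k _ /=; rewrite lE; ring.
by rewrite vi vj !mulr0 addr0.
Qed.

Hypothesis odt : only_double_triple l.

Lemma exact_card (B : {set 'I_d}) : exact_point_set l B -> (#|B| <= 3)%N.
Proof.
move=> eB; rewrite leqNgt; apply/negP => B4.
have /eqP := odt B4; rewrite /nmult cards_eq0 => /eqP/setP/(_ B).
by rewrite !inE eqxx /= => /asboolP.
Qed.

Lemma no_quadruple i1 i2 i3 n : uniq [:: i1; i2; i3; n] -> conc l i1 i2 n -> conc l i1 i3 n -> False.
Proof.
move=> u c2 c3.
have n1 : i1 != n by move: u; rewrite /= !inE !negb_or => /andP[/and3P[]].
have := exact_card (meetset_exact n1); rewrite leqNgt => /negP; apply.
apply: (@leq_trans #|[set:: [:: i1; i2; i3; n]]|).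
  by rewrite cardsE (card_uniqP u).
apply/subset_leq_card/subsetP => x; rewrite inE.
rewrite !inE => /or4P[] /eqP ->; rewrite ?[conc _ _ _ i2]concCA ?[conc _ _ _ i3]concCA //.
  by have := meetset_l i1 n; rewrite inE.
by have := meetset_r i1 n; rewrite inE.
Qed.

Definition points : {set {set 'I_d}} := [set B : {set 'I_d} | (1 < #|B|)%N && `[< exact_point_set l B >]].
Definition npt (i : 'I_d) k := #|[set B : {set 'I_d} in points | (i \in B) && (#|B| == k)]|.

Lemma pointsP (B : {set 'I_d}) : B \in points -> (1 < #|B|)%N /\ exact_point_set l B.
Proof. by rewrite inE => /andP[? /asboolP]. Qed.

Lemma points_card (B : {set 'I_d}) : B \in points -> (#|B| == 2)%N || (#|B| == 3)%N.
Proof. by move/pointsP => [h /exact_card]; case: #|B| h => [|[|[|[|]]]]. Qed.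

Lemma nmultE k : (1 < k)%N -> nmult l k = #|[set B : {set 'I_d} in points | #|B| == k]|.
Proof.
move=> k1; rewrite /nmult; congr #|pred_of_set _|; apply/setP => B; rewrite !inE andbC -andbA.
by case: eqP => [->|]; rewrite ?k1 ?andbT ?andbF.
Qed.

Lemma meetset_points i j : i != j -> meetset i j \in points.
Proof.
move=> ij; rewrite inE; apply/andP; split; last exact/asboolP/meetset_exact.
by apply/card_gt1P; exists i, j; rewrite meetset_l meetset_r.
Qed.

(** The other [d - 1] lines are sorted by the point where they cross the line [i]. *)
Lemma npt_sum i : (npt i 2 + 2 * npt i 3 = d.-1)%N.
Proof.
have -> : d.-1 = (\sum_(j | j != i) 1)%N.
  by rewrite sum1_card cardC1 card_ord.
rewrite (partition_big (meetset i) (fun B => (B \in points) && (i \in B))) /=; last first.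
  by move=> j ji; rewrite meetset_points 1?eq_sym // meetset_l.
rewrite (eq_bigr (fun B : {set 'I_d} => #|B|.-1)); last first.
  move=> B /andP[/pointsP[_ eB] iB]; rewrite (cardsD1 i B) iB /= -sum1_card.
  apply: eq_bigl => j; rewrite !inE; case: (eqVneq j i) => //= ji.
  apply/eqP/idP => [<-|jB]; first exact: meetset_r.
  by apply/esym/exact_meetset; rewrite // eq_sym.
rewrite (bigID (fun B : {set 'I_d} => #|B| == 2)) /=; congr addn.
  rewrite (eq_bigr (fun=> 1%N)); last by move=> B /andP[_ /eqP ->].
  by rewrite sum1dep_card; congr #|pred_of_set _|; apply/setP => B; rewrite [LHS]inE [RHS]inE -andbA.
rewrite (eq_bigr (fun=> 2%N)); last first.
  by move=> B /andP[/andP[/points_card /orP[/eqP ->//|/eqP ->//]]].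
rewrite sum_nat_cond_const [RHS]mulnC /npt; congr (_ * #|pred_of_set _|)%N; apply/setP => B.
rewrite [LHS]inE [RHS]inE -andbA.
by have [/points_card/orP[]/eqP ->|//] := boolP (B \in points); rewrite ?andbF.
Qed.

Lemma sum_npt k : (1 < k)%N -> (\sum_i npt i k = k * nmult l k)%N.
Proof.
move=> k1; rewrite nmultE //.
transitivity (\sum_(B in [set B : {set 'I_d} in points | #|B| == k]) #|B|)%N; last first.
  rewrite (eq_bigr (fun=> k)); first by rewrite sum_nat_const mulnC.
  by move=> B; rewrite inE => /andP[_ /eqP].
rewrite (eq_bigr (fun i => \sum_(B in [set B : {set 'I_d} in points | #|B| == k]) (i \in B))%N).
  rewrite exchange_big; apply: eq_bigr => B _ /=.
  by rewrite -sum1_card [RHS]big_mkcond; apply: eq_bigr => i _; case: (i \in B).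
move=> i _; rewrite /npt -sum1_card [LHS]big_mkcond [RHS]big_mkcond.
apply: eq_bigr => B _; rewrite [in LHS]inE [in RHS]inE.
by case: (B \in points); case: (i \in B) => //=; case: ifP.
Qed.

(** [npt_sum] is summed over all lines, a point being counted once on each line through it. *)
Lemma pairs_count : (d * d.-1 = 2 * nmult l 2 + 6 * nmult l 3)%N.
Proof.
have := sum_npt (isT : (1 < 2)%N); have := sum_npt (isT : (1 < 3)%N).
have : (\sum_i (npt i 2 + 2 * npt i 3) = d * d.-1)%N.
  by rewrite (eq_bigr (fun=> d.-1)) ?sum_nat_const ?card_ord // => i _; apply: npt_sum.
rewrite big_split /= -big_distrr /=; lia.
Qed.

(* A triple point is counted at its two largest lines. *)
Lemma sum_sec : (\sum_(n < d) #|[set i : 'I_d | (i < n)%N && sec l n i]| = nmult l 3)%N.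
Proof.
pose Pr := [set p : 'I_d * 'I_d | (p.1 < p.2)%N && sec l p.2 p.1].
have PrE p : p \in Pr -> exists i' : 'I_d, [/\ (i' < p.1)%N, (p.1 < p.2)%N & meetset p.1 p.2 = [set i'; p.1; p.2]].
  rewrite inE => /andP[h12 /existsP[i' /andP[h1 c]]]; exists i'; split=> //.
  have n12 : p.1 != p.2 by apply: contraTneq h12 => ->; rewrite ltnn.
  apply/esym/eqP; rewrite eqEcard; apply/andP; split.
    apply/subsetP => x; rewrite !inE => /orP[/orP[]|] /eqP ->.
    - by rewrite concC concCA concC concCA.
    - by have := meetset_l p.1 p.2; rewrite inE.
    - by have := meetset_r p.1 p.2; rewrite inE.
  rewrite (leq_trans (exact_card (meetset_exact n12))) //.
  apply: (@leq_trans #|[set:: [:: i'; p.1; p.2]]|).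
    rewrite (_ : #|_| = 3) //; rewrite cardsE; apply/card_uniqP; rewrite /= !inE negb_or andbT -!val_eqE /=; lia.
  by apply/subset_leq_card/subsetP => x; rewrite !inE => /or3P[] ->; rewrite ?orbT.
transitivity #|Pr|.
  rewrite -sum1_card (eq_bigr (fun n : 'I_d => \sum_(i : 'I_d | (i < n)%N && sec l n i) 1)%N); last first.
    by move=> n _; rewrite -sum1_card; apply: eq_bigl => i; rewrite inE.
  rewrite pair_big_dep /=.
  rewrite (reindex (fun p : 'I_d * 'I_d => (p.2, p.1))) /=; last first.
    by exists (fun p : 'I_d * 'I_d => (p.2, p.1)) => -[].
  by apply: eq_bigl => p; rewrite inE.
rewrite nmultE // -(card_in_imset (f := fun p : 'I_d * 'I_d => meetset p.1 p.2)) /=; last first.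
  move=> [i n] [j m] /PrE [i' /= [h1 h2 E1]] /PrE [j' /= [h3 h4 E2]] E.
  have mem x : x \in [set i'; i; n] = (x \in [set j'; j; m]) by rewrite -E1 E E2.
  have := mem i'; have := mem i; have := mem n; have := mem j'; have := mem j; have := mem m.
  rewrite !inE !eqxx ?orbT /= -!val_eqE /= => a1 a2 a3 a4 a5 a6.
  by congr pair; apply: val_inj => /=; lia.
congr #|pred_of_set _|; apply/setP => B; apply/imsetP/idP => [[p pP ->]|].
  have [i' [h1 h2 E]] := PrE _ pP.
  have n12 : p.1 != p.2 by apply: contraTneq h2 => ->; rewrite ltnn.
  rewrite inE meetset_points //= E.
  have -> : [set i'; p.1; p.2] = [set:: [:: i'; p.1; p.2]] by apply/setP => x; rewrite !inE orbA.
  by rewrite cardsE; apply/eqP/card_uniqP; rewrite /= !inE negb_or -!val_eqE /= !neq_ltn h1 h2 (ltn_trans h1 h2).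
rewrite inE => /andP[/pointsP[_ eB] /eqP B3].
have [x0 x0B] : exists x, x \in B by apply/card_gt0P; rewrite B3.
(* Conversely, the lines of a triple point are put in order [i < j < n]; the pair [(j, n)] maps to
   this point. *)
have [n nB0 nmax] := @arg_maxnP _ x0 (mem B) val x0B; have nB : n \in B := nB0.
have /eqP/cards2P [i [j [ij Bn]]] : #|B :\ n| = 2 by move: (cardsD1 n B); rewrite B3 nB => -[].
have {i j ij Bn} [i [j [ij Bn]]] : exists i j : 'I_d, (i < j)%N /\ B :\ n = [set i; j].
  case: (ltngtP i j) => [h|h|/val_inj e]; [by exists i, j|exists j, i|by rewrite e eqxx in ij].
  by rewrite Bn setUC.
have [jn0 jB] : j != n /\ j \in B.
  by have : j \in B :\ n; [rewrite Bn !inE eqxx orbT|rewrite !inE => /andP[]].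
have iB : i \in B.
  by have : i \in B :\ n; [rewrite Bn !inE eqxx|rewrite !inE => /andP[]].
have jn : (j < n)%N by rewrite ltn_neqAle val_eqE jn0; apply/nmax/jB.
exists (j, n) => /=; last by apply: exact_meetset jn0 => //; apply: jB.
rewrite inE /= jn; apply/existsP; exists i; rewrite ij /=.
have -> : conc l i j n = (i \in meetset j n) by rewrite inE concC concCA.
by rewrite -(exact_meetset eB jB nB jn0).
Qed.
End Combinatorics.

(** * The Hilbert function from the two sides *)

(** Tangency to one more line [n] is the kernel of the restriction map and costs
    [k + 1 - size (cls l n true)] dimensions by [step_dim]. Sums stand on both sides to avoid
    truncated subtraction. *)
Lemma dim_logder_aux d (l : 'I_d -> 'I_3 -> C) k m : line_arrangement l -> only_double_triple l ->
  (d <= k)%N -> (m <= d)%N ->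
  exists U : {vspace vfield k},
    (forall th : vfield k, th \in U <->
       (forall i : 'I_d, (i < m)%N -> vanish (plane (l i)) (vapp (vf th) (l i)))) /\
    (\dim U + \sum_(n < d | (n < m)%N) k.+1 = 3 * 'C(k + 2, k) + \sum_(n < d | (n < m)%N) size (cls l n true))%N.
Proof.
move=> arr odt dk; elim: m => [_|m IH md].
  exists fullv; split=> [th|]; first by rewrite memvf.
  by rewrite dim_vfield !big_pred0.
have [U [hU dU]] := IH (ltnW md).
pose n := Ordinal md.
have [u [w [pu pw iuw hw]]] := generic_basis arr n.
have nk : (n <= k)%N by rewrite (leq_trans _ dk) // ltnW.
have hst := step_dim arr (no_quadruple arr odt) pu pw iuw hw nk hU.
exists (U :&: lker (linfun (@resl (l n) u w k)))%VS; split=> [th|].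
  rewrite memv_cap memv_ker lfunE /=; split.
    move=> /andP[/hU hth /eqP rth] i; rewrite ltnS leq_eqVlt => /orP[/eqP im|]; last exact: hth.
    have -> : i = n by apply: val_inj.
    apply: (pline0_plane (arr.1 n) pu pw iuw (vapp_homog th (l n))).
    by rewrite -reslE rth.
  move=> hth; apply/andP; split; first by apply/hU => i im; apply: hth; rewrite ltnS ltnW.
  apply/eqP/val_inj; rewrite [LHS]reslE; apply: poly_eval0 => x.
  by rewrite pline_eval; apply: (hth n (ltnSn m)); apply: rt_plane.
have := limg_ker_dim (linfun (@resl (l n) u w k)) U; rewrite hst.
have hsz : (size (cls l n true) <= n)%N.
  by have := size_cls l n; lia.
have E (F : 'I_d -> nat) : (\sum_(i < d | (i < m.+1)%N) F i = F n + \sum_(i < d | (i < m)%N) F i)%N.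
  rewrite (bigD1 n) /=; last by rewrite ltnS.
  congr addn; apply: eq_bigl => i; rewrite -val_eqE /= ltnS ltn_neqAle andbC //.
rewrite !E => dimE; have {}nk : (m <= k)%N := nk; have {}hsz : (size (cls l n true) <= m)%N := hsz.
move: dU dimE nk hsz; clear.
move: (\dim _) (\dim _) (size _) (\sum_(i < d | _) _)%N (\sum_(i < d | _) _)%N ('C(_, _)) => a b c e f g.
lia.
Qed.

Lemma dim_logder d (l : 'I_d -> 'I_3 -> C) k : line_arrangement l -> only_double_triple l -> (d <= k)%N ->
  exists U : {vspace vfield k}, (forall th : vfield k, th \in U <-> logder l (vf th)) /\
    (\dim U + d * k.+1 = 3 * 'C(k + 2, k) + nmult l 3)%N.
Proof.
move=> arr odt dk; have [U [hU dU]] := dim_logder_aux arr odt dk (leqnn d).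
exists U; split=> [th|]; first by rewrite hU; split=> h i; [apply: h|move=> _; apply: h].
move: dU; rewrite -(sum_sec arr odt).
rewrite (eq_bigl predT) => [|i]; last by rewrite ltn_ord.
rewrite sum_nat_const card_ord => ->; congr addn.
rewrite (eq_bigl predT) => [|i]; last by rewrite ltn_ord.
apply: eq_bigr => n _; rewrite -sum1dep_card -sum1_size big_filter big_enum_cond /=.
by apply: eq_bigl => i; rewrite eqb_id.
Qed.

(** Coefficients supplied by generation or division need not be homogeneous; this replaces them by
    their component of the right degree. *)
Lemma pihomogMr k b (p r : S) : r \is b.-homog -> (b <= k)%N ->
  pihomog mdeg k (p * r) = pihomog mdeg (k - b) p * r.
Proof.
move=> hr bk; pose N := maxn (msize p) (k - b).+1.
rewrite {1}(@pihomog_partitionE _ _ mdeg N p) ?leq_maxl // mulr_suml raddf_sum /=.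
have kN : (k - b < N)%N by rewrite leq_maxr.
rewrite (bigD1 (Ordinal kN)) //= big1 => [|e eN].
  rewrite addr0 pihomog_dE //.
  by have := dhomogM (pihomogP mdeg (k - b) p) hr; rewrite subnK.
apply: (@pihomog_ne0 _ _ mdeg (e + b)%N); last by apply: dhomogM hr; apply: pihomogP.
by apply: contraNneq eN => ek; apply/eqP/val_inj => /=; lia.
Qed.

(** * The resolution in a fixed degree *)

Section Resolution.
Variables (d : nat) (l : 'I_d -> 'I_3 -> C).
Hypotheses (arr : line_arrangement l) (d0 : (0 < d)%N).
Variables (dd : 'I_3 -> nat) (r : 'I_3 -> 'I_3 -> S) (h : 'I_3 -> S) (kh : 'I_3 -> nat) (rho : nat).
Hypotheses (hr : forall j c, r j c \is (dd j).-homog)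
  (hsyz : forall j, is_syz (defpoly l) (r j))
  (hgen : forall s, is_syz (defpoly l) s -> exists g : 'I_3 -> S, forall c, s c = \sum_(j < 3) g j * r j c)
  (hh : forall j, h j \is (kh j).-homog /\ (rho = kh j + dd j)%N)
  (hne : exists j, h j != 0)
  (hker : forall g : 'I_3 -> S, (forall c, \sum_(j < 3) g j * r j c = 0) <-> (exists t : S, forall j, g j = t * h j)).
Variable k : nat.
Hypotheses (k0 : (0 < k)%N) (kdd : forall j, (dd j <= k)%N) (krho : (rho <= k)%N).

Lemma defpoly_neq0 : defpoly l != 0.
Proof.
apply/prodf_neq0 => i _; apply/eqP => e0; have [c ac] := arr.1 i.
by have := congr1 (meval (bvec c)) e0; rewrite meval_linform dot_bvec meval0 => /eqP; rewrite (negbTE ac).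
Qed.

(** Coefficients of [r o0], [r o1], [r o2] and of the Euler field in a vector field of degree
    [k]. *)
Local Notation W := (dhomog 3 C (k - dd o0) * dhomog 3 C (k - dd o1) * dhomog 3 C (k - dd o2) * dhomog 3 C (k - 1))%type.

Definition resg (x : W) : 'I_3 -> S := fun j =>
  if j == o0 then val x.1.1.1 else if j == o1 then val x.1.1.2 else val x.1.2.

Definition resc (x : W) (c : 'I_3) : S := \sum_j resg x j * r j c + val x.2 * 'X_c.

Lemma resc_homog x c : resc x c \is k.-homog.
Proof.
have hX : ('X_c : S) \is 1.-homog by rewrite dhomogX /= mdeg1.
rewrite rpredD //; last by have := dhomogM (dhomog_is_dhomog x.2) hX; rewrite subnK.
apply: rpred_sum => j _.
have hg : resg x j \is (k - dd j).-homog.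
  by elim/ord3P: j; rewrite /resg ?eqxx ?ord3_neq; apply: dhomog_is_dhomog.
by have := dhomogM hg (hr j c); rewrite subnK.
Qed.

Definition resmap (x : W) : vfield k := [ffun c => insubd (0 : dhomog 3 C k) (resc x c)].

Lemma vf_resmap x c : vf (resmap x) c = resc x c.
Proof. by rewrite /vf ffunE val_insubd resc_homog. Qed.

Lemma resmap_linear : linear resmap.
Proof.
move=> a x y; apply/ffunP => c; apply/val_inj; rewrite [LHS]vf_resmap.
rewrite !ffunE /= !val_insubd !resc_homog /resc !big_ord3 /resg ?eqxx ?ord3_neq /= -!mul_mpolyC.
ring.
Qed.

Lemma syz_comb (g : 'I_3 -> S) t : \sum_c (\sum_j g j * r j c + t * 'X_c) * mderiv c (defpoly l) = t * (d%:R * defpoly l).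
Proof.
rewrite -syz_euler mulr_sumr; under eq_bigr => c _ do rewrite mulrDl.
rewrite big_split /= [X in X + _](_ : _ = 0) ?add0r; last first.
  under eq_bigr => c _ do rewrite mulr_suml.
  rewrite exchange_big big1 // => j _ /=.
  under eq_bigr => c _ do rewrite -mulrA.
  by rewrite -mulr_sumr [X in _ * X](hsyz j) mulr0.
by apply: eq_bigr => c _; rewrite mulrA.
Qed.

(** Applied to [f], the syzygies give zero and the Euler field gives [d f]; hence the coefficient
    [t] vanishes and a relation among the [r j] remains. *)
Lemma res_relation (g : 'I_3 -> S) t : (forall c, \sum_j g j * r j c + t * 'X_c = 0) ->
  t = 0 /\ exists s, forall j, g j = s * h j.
Proof.
move=> e0; have t0 : t = 0.
  have := syz_comb g t; rewrite big1 => [|c _]; last by rewrite e0 mul0r.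
  move/esym/eqP; rewrite mulrA mulf_eq0 (negbTE defpoly_neq0) orbF mulf_eq0 => /orP[/eqP//|].
  by rewrite -mpolyC_nat mpolyC_eq0 pnatr_eq0 => /eqP dz; move: d0; rewrite dz.
split=> //; apply/hker => c; by rewrite -[RHS](e0 c) t0 mul0r addr0.
Qed.

Lemma logder_res (th : vfield k) : logder l (vf th) <-> exists x, th = resmap x.
Proof.
split=> [lth|[x ->]]; last first.
  move=> i; suff -> : vapp (vf (resmap x)) (l i) = \sum_j resg x j * vapp (r j) (l i) + val x.2 * linform (l i).
    move=> v lv; rewrite mevalD mevalM meval_linform [dot _ v]lv mulr0 addr0 raddf_sum big1 // => j _ /=.
    by rewrite mevalM (syz_logder arr (hsyz j)) // mulr0.
  rewrite /vapp (eq_bigr (fun c => l i c *: resc x c)); last by move=> c _; rewrite vf_resmap.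
  rewrite /resc; under eq_bigr => c _ do rewrite scalerDr scaler_sumr.
  rewrite big_split /= exchange_big /= mulr_sumr; congr (_ + _).
    apply: eq_bigr => j _; rewrite mulr_sumr; apply: eq_bigr => c _.
    by rewrite scalerAr.
  by apply: eq_bigr => c _; rewrite scalerAr.
have [t ht] := logder_decomp d0 arr lth.
have [g gE] := hgen ht.
pose x : W := (insubd (0 : dhomog 3 C _) (pihomog mdeg (k - dd o0) (g o0)),
  insubd (0 : dhomog 3 C _) (pihomog mdeg (k - dd o1) (g o1)),
  insubd (0 : dhomog 3 C _) (pihomog mdeg (k - dd o2) (g o2)),
  insubd (0 : dhomog 3 C _) (pihomog mdeg (k - 1) t)).
exists x; apply/ffunP => c; apply/val_inj; change (vf th c = vf (resmap x) c); rewrite vf_resmap.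
have hX : ('X_c : S) \is 1.-homog by rewrite dhomogX /= mdeg1.
have -> : vf th c = pihomog mdeg k (\sum_j g j * r j c + t * 'X_c).
  by rewrite -gE /euler subrK pihomog_dE //; apply: dhomog_is_dhomog.
rewrite raddfD raddf_sum /= (pihomogMr _ hX) // /resc; congr (_ + _).
  apply: eq_bigr => j _; rewrite (pihomogMr _ (hr j c)) //; congr (_ * _).
  by elim/ord3P: j; rewrite /resg ?eqxx ?ord3_neq val_insubd pihomogP.
by rewrite val_insubd pihomogP.
Qed.

(** Rank-nullity for [resmap], whose kernel is a copy of the forms of degree [k - rho], embedded by
    multiplication with [h]. *)
Lemma res_dim : exists U : {vspace vfield k}, (forall th : vfield k, th \in U <-> logder l (vf th)) /\
  (\dim U + 'C(k - rho + 2, k - rho) =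
   'C(k - dd o0 + 2, k - dd o0) + 'C(k - dd o1 + 2, k - dd o1) + 'C(k - dd o2 + 2, k - dd o2) + 'C(k - 1 + 2, k - 1))%N.
Proof.
have fL := GRing.isLinear.Build C W (vfield k) _ resmap resmap_linear.
pose f : {linear W -> vfield k} := HB.pack resmap fL.
have fE x : linfun f x = resmap x by rewrite lfunE.
exists (limg (linfun f)); split=> [th|].
  rewrite logder_res; split=> [/memv_imgP[x _ ->]|[x ->]]; first by exists x; rewrite fE.
  by rewrite -fE memv_img // memvf.
have := limg_ker_dim (linfun f) fullv; rewrite capfv => E.
have -> : 'C(k - rho + 2, k - rho) = \dim (lker (linfun f)).
  have khE j : (k - dd j = k - rho + kh j)%N by have [_ e] := hh j; have := kdd j; lia.
  have hth j (t : dhomog 3 C (k - rho)) : val t * h j \is (k - dd j).-homog.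
    by rewrite khE; apply: dhomogM (dhomog_is_dhomog t) (hh j).1.
  pose gm (t : dhomog 3 C (k - rho)) : W := (DHomog (hth o0 t), DHomog (hth o1 t), DHomog (hth o2 t), 0).
  have gl : linear gm.
    move=> a x y; rewrite /gm; congr (_, _, _, _); try (apply/val_inj; rewrite /= mulrDl scalerAl //).
    by change (0 = a *: 0 + 0 :> dhomog 3 C (k - 1)); rewrite scaler0 addr0.
  have gL := GRing.isLinear.Build C (dhomog 3 C (k - rho)) W _ gm gl.
  pose g : {linear dhomog 3 C (k - rho) -> W} := HB.pack gm gL.
  have gE x : linfun g x = gm x by rewrite lfunE.
  have resgm t j : resg (gm t) j = val t * h j.
    by elim/ord3P: j; rewrite /resg ?eqxx ?ord3_neq.
  have -> : lker (linfun f) = limg (linfun g).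
    apply/vspaceP => x; rewrite memv_ker fE; apply/eqP/memv_imgP => [e0|[t _ ->]]; last first.
      apply/ffunP => c; apply/val_inj; rewrite [LHS]vf_resmap !ffunE /= /resc gE /= mul0r addr0.
      have := (hker (resg (gm t))).2; apply; exists (val t) => j; exact: resgm.
    have [c|x20 [s sE]] := @res_relation (resg x) (val x.2).
      by rewrite -/(resc x c) -vf_resmap e0 /vf ffunE.
    pose t : dhomog 3 C (k - rho) := insubd (0 : dhomog 3 C _) (pihomog mdeg (k - rho) s).
    exists t; first by rewrite memvf.
    have tE j : resg x j = val t * h j.
      rewrite val_insubd pihomogP (_ : (k - rho = (k - dd j) - kh j)%N); last first.
        by rewrite khE addnK.
      rewrite -(pihomogMr _ (hh j).1) -?sE; last by rewrite khE leq_addl.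
      rewrite pihomog_dE //.
      by elim/ord3P: j; rewrite /resg ?eqxx ?ord3_neq; apply: dhomog_is_dhomog.
    rewrite gE /gm; case: x x20 tE {e0 sE} => [[[x0 x1] x2] x3] /= x30 tE.
    congr (_, _, _, _); apply/val_inj => //=.
    - by have := tE o0; rewrite /resg eqxx.
    - by have := tE o1; rewrite /resg eqxx ord3_neq.
    - by have := tE o2; rewrite /resg !ord3_neq.
  rewrite limg_dim_eq ?dimvf //; apply/eqP; rewrite capfv; apply/lker0P => t1 t2.
  rewrite !gE => e; have [j hj] := hne; apply/val_inj/(mulIf hj).
  by rewrite -!resgm e.
by move: E; rewrite dimvf /dim /= addnC.
Qed.
End Resolution.

(** * Lower bound on the degree of a syzygy *)

Lemma homog1_linform (p : S) : p \is 1.-homog -> exists a, p = linform a.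
Proof.
move=> hp; exists (fun k => p@_(U_(k))%MM); apply/mpolyP => m.
rewrite /linform raddf_sum /=; under eq_bigr => k _ do rewrite mcoeffZ mcoeffX.
have [/eqP/mdeg1P [j /eqP ->]|m1] := eqVneq (mdeg m) 1%N.
  rewrite (bigD1 j) //= eqxx mulr1 big1 ?addr0 // => k kj.
  rewrite (_ : (U_(k) == U_(j))%MM = false) ?mulr0 //; apply/eqP => /mnmP /(_ j).
  by rewrite !mnmE eqxx (negbTE kj).
rewrite (dhomog_nemf_coeff hp) // big1 // => k _.
rewrite (_ : (U_(k) == m)%MM = false) ?mulr0 //; apply: contraNF m1 => /eqP <-.
by rewrite mdeg1.
Qed.

(** Were [cross tau v] nonzero, [a] and [b] would both be multiples of it. *)
Lemma orth_parallel a b tau v : indep a b -> dot a tau = 0 -> dot a v = 0 -> dot b tau = 0 -> dot b v = 0 ->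
  forall k, cross tau v k = 0.
Proof.
move=> iab at0 av bt bv; apply: contrapT => /existsNP [k /eqP nk].
have nz : exists k, cross tau v k != 0 by exists k.
have [|c cE] := @not_indep a (cross tau v) nz.
  by move=> [j]; rewrite triple_cross // eqxx.
have [|c' c'E] := @not_indep b (cross tau v) nz.
  by move=> [j]; rewrite triple_cross // eqxx.
have [j /eqP] := iab; apply; elim/ord3P: j; rewrite !crossE !cE !c'E; ring.
Qed.

Definition evalv (D : 'I_3 -> S) (v : 'I_3 -> C) : 'I_3 -> C := fun c => (D c).@[v].

Lemma meval_cross D E v c : (cross D E c).@[v] = cross (evalv D v) (evalv E v) c.
Proof. by elim/ord3P: c; rewrite !crossE mevalB !mevalM. Qed.

Lemma meval_vapp D a v : (vapp D a).@[v] = dot a (evalv D v).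
Proof. by rewrite /vapp raddf_sum; apply: eq_bigr => c _; rewrite /= mevalZ. Qed.

Lemma evalv_euler v c : evalv euler v c = v c.
Proof. exact: mevalXU. Qed.

Section Mdr.
Variables (d : nat) (l : 'I_d -> 'I_3 -> C).
Hypotheses (arr : line_arrangement l) (odt : only_double_triple l).
Variables (r : nat) (D : 'I_3 -> S).
Hypotheses (hD : forall c, D c \is r.-homog) (sD : is_syz (defpoly l) D) (D0 : exists c, D c != 0).
Hypotheses (r0 : (0 < r)%N) (d0 : (0 < d)%N).

Lemma cross_homog c : cross D euler c \is (r + 1).-homog.
Proof.
have hX j : euler j \is 1.-homog by rewrite dhomogX /= mdeg1.
by elim/ord3P: c; rewrite !crossE rpredB // dhomogM.
Qed.

(** At a point where [i] meets another line, both the value of [D] and the point itself lie in the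
    two planes, hence are parallel. A form of degree [r + 1] with [r + 2] zeros on a projective line
    is zero. *)
Lemma cross_vanish i c : (r + 2 <= npt l i 2 + npt l i 3)%N -> vanish (plane (l i)) (cross D euler c).
Proof.
move=> hi; have lD := syz_logder arr sD.
have [u [w [pu pw iuw hw]]] := generic_basis arr i.
apply: (pline0_plane (arr.1 i) pu pw iuw (cross_homog c)).
pose Q := [set B : {set 'I_d} in points l | i \in B].
have Qcard : (#|Q| = npt l i 2 + npt l i 3)%N.
  rewrite -(cardsID [set B : {set 'I_d} | #|B| == 2]) /npt; congr addn; apply: eq_card => B.
    by rewrite in_setI 3!inE -andbA.
  rewrite in_setD [B \in Q]inE [B \in [set _ | #|_| == 2]]inE [RHS]inE.
  have [/points_card|] := boolP (B \in points l); rewrite ?andbF //.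
  by move=> /(_ odt)/orP[]/eqP ->; case: (i \in B).
(* Another line through the point [B]; the default [i] is never taken on [Q]. *)
pose j0 (B : {set 'I_d}) := odflt i [pick j in B | j != i].
have j0P B : B \in Q -> j0 B \in B /\ j0 B != i.
  rewrite inE => /andP[/pointsP[B1 _] iB]; rewrite /j0; case: pickP => [j /andP[]//|h].
  have [x [y [xB yB xy]]] := card_gt1P B1.
  have := h x; have := h y; rewrite xB yB /= => /negbFE/eqP yi /negbFE/eqP xi; by rewrite xi yi eqxx in xy.
have BE B : B \in Q -> B = meetset l i (j0 B).
  move=> BQ; have [jB ji] := j0P B BQ; move: BQ; rewrite inE => /andP[/pointsP[_ eB] iB].
  by apply: exact_meetset => //; rewrite eq_sym.
apply: (@roots_geq_poly_eq0 _ _ [seq rt l u w (j0 B) | B <- enum Q]).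
- apply/allP => x /mapP[B]; rewrite mem_enum => BQ ->; have [jB ji] := j0P B BQ.
  rewrite rootE pline_eval meval_cross; apply/eqP.
  set v := addv3 _ u w.
  have vi : dot (l i) v = 0 by apply: rt_plane.
  have vj : dot (l (j0 B)) v = 0 by apply: (@rt_point d l i u w hw).
  rewrite (_ : cross _ _ c = cross (evalv D v) v c); last first.
    by elim/ord3P: c; rewrite !crossE !evalv_euler.
  apply: (@orth_parallel (l i) (l (j0 B))) => //; first by apply: arr_indep; rewrite // eq_sym.
    by rewrite -meval_vapp lD.
  by rewrite -meval_vapp lD.
- rewrite map_inj_in_uniq ?enum_uniq // => B1 B2; rewrite !mem_enum => Q1 Q2 e.
  have [jB1 ji1] := j0P B1 Q1; have [jB2 ji2] := j0P B2 Q2.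
  have [e0|ne] := eqVneq (j0 B1) (j0 B2); first by rewrite (BE B1 Q1) (BE B2 Q2) e0.
  have c12 : conc l (j0 B1) (j0 B2) i by rewrite -(rt_conc arr pu pw iuw hw ji1 ji2 ne) e.
  have := Q1; rewrite inE => /andP[/pointsP[_ e1] iB1].
  have := Q2; rewrite inE => /andP[/pointsP[_ e2] iB2].
  rewrite (exact_meetset arr e2 iB2 jB2) 1?eq_sym //; apply: exact_meetset => //; last by rewrite eq_sym.
  by rewrite (BE B1 Q1) inE concC concCA.
- by rewrite size_map -cardE Qcard (leq_trans (size_pline _ _ (cross_homog c))) // -addn2 -addnS.
Qed.

(** If all components were zero, [D] would be [s v] at each point [v] off the curve; the syzygy then
    reads [s d f(v) = 0], so [D c * f] vanishes everywhere. *)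
Lemma cross_neq0 : exists c, cross D euler c != 0.
Proof.
apply: contrapT => /forallNP h0; have [c /eqP Dc] := D0; apply: Dc.
have h c' : cross D euler c' = 0 by apply/eqP/negPn/negP/h0.
have f0 := defpoly_neq0 arr.
suff : D c * defpoly l = 0 by move/eqP; rewrite mulf_eq0 (negbTE f0) orbF => /eqP.
apply: mpoly_eval0 => v; rewrite mevalM; have [->|fv] := eqVneq (defpoly l).@[v] 0; first by rewrite mulr0.
have vN : exists k, v k != 0.
  apply: contrapT => /forallNP v0; move: fv; rewrite /defpoly rmorph_prod /= (bigD1 (Ordinal d0)) //=.
  rewrite meval_linform /dot big1 ?mul0r ?eqxx // => k _.
  by have /negP/negPn/eqP -> := v0 k; rewrite mulr0.
have [|s sE] := @not_indep (evalv D v) v vN.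
  move=> [k /eqP]; apply; transitivity (cross D euler k).@[v]; last by rewrite h meval0.
  by rewrite meval_cross; elim/ord3P: k; rewrite !crossE !evalv_euler.
have := congr1 (meval v) sD; rewrite meval0 raddf_sum /=.
rewrite (eq_bigr (fun k => s * (euler k * mderiv k (defpoly l)).@[v])); last first.
  by move=> k _; rewrite !mevalM -[(D k).@[v]]/(evalv D v k) sE -/(evalv euler v k) evalv_euler mulrA.
rewrite -mulr_sumr -raddf_sum /= syz_euler mevalM -mpolyC_nat mevalC => /eqP.
rewrite !mulf_eq0 (negbTE fv) pnatr_eq0 orbF => /orP[/eqP s0|/eqP dz]; last by have := d0; rewrite {1}dz.
by rewrite -[(D c).@[v]]/(evalv D v c) sE s0 !mul0r.
Qed.

(** The coefficient matrix of [q] is skew, by evaluation at basis vectors and at sums of two of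
    them, and a skew matrix of order three acts as a cross product. *)
Lemma skew_cross (q : 'I_3 -> S) : (forall c, q c \is 1.-homog) -> \sum_c q c * 'X_c = 0 ->
  exists a : 'I_3 -> C, forall c v, (q c).@[v] = cross a v c.
Proof.
move=> hq q0.
have /choice [A AE] : forall c, exists a, q c = linform a by move=> c; apply: homog1_linform.
have qv v : \sum_c dot (A c) v * v c = 0.
  transitivity (\sum_c q c * 'X_c).@[v]; last by rewrite q0 meval0.
  rewrite raddf_sum; apply: eq_bigr => c _ /=.
  by rewrite mevalM mevalXU AE meval_linform.
have diag c : A c c = 0.
  have := qv (bvec c); rewrite (bigD1 c) //= big1 => [|k kc]; last by rewrite /bvec (negbTE kc) mulr0.
  by rewrite dot_bvec /bvec eqxx mulr1 addr0.
have skew c k : A k c = - A c k.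
  have := qv (fun j => bvec c j + bvec k j).
  have dD a : dot a (fun j => bvec c j + bvec k j) = a c + a k.
    rewrite -(dot_bvec a c) -(dot_bvec a k) /dot -big_split; apply: eq_bigr => j _ /=; ring.
  under eq_bigr => j _ do rewrite dD mulrDr.
  rewrite big_split /= (bigD1 c) //= big1 => [|j jc]; last by rewrite /bvec (negbTE jc) mulr0.
  rewrite (bigD1 k) //= big1 => [|j jk]; last by rewrite /bvec (negbTE jk) mulr0.
  rewrite /bvec !eqxx !mulr1 !diag add0r !addr0 => /eqP; rewrite addrC addr_eq0 => /eqP //.
exists (fun j => if j == o0 then A o2 o1 else if j == o1 then A o0 o2 else A o1 o0) => c v.
rewrite AE meval_linform /dot big_ord3.
elim/ord3P: c; rewrite !crossE ?eqxx ?ord3_neq diag.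
- by rewrite (skew o1 o0); ring.
- by rewrite (skew o2 o1); ring.
- by rewrite (skew o0 o2); ring.
Qed.

(** The quotient [q] of [D x E] by the product [F] is orthogonal to [E], hence equal to [a x E], so
    [D - F a] is parallel to [E]. At a point of a line outside [T] where [F] is nonzero, [D] and [E]
    lie in the plane of that line, hence so does [a]. *)
Lemma mdr_bound (T : {set 'I_d}) : #|T| = r ->
  (forall i, i \in T -> (r + 2 <= npt l i 2 + npt l i 3)%N) ->
  exists2 B : {set 'I_d}, exact_point_set l B & (d - r <= #|B|)%N.
Proof.
move=> cT hT; pose F := \prod_(i <- enum T) linform (l i).
have hF : F \is r.-homog by rewrite -cT cardE; apply: homog_prodlin.
have F0 : F != 0.
  apply/eqP => e0; have := defpoly_neq0 arr.
  rewrite /defpoly (bigID (mem T)) /= -big_enum /= -/F e0 mul0r eqxx //.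
have /choice [q0 q0E] : forall c, exists q, cross D euler c = F * q.
  move=> c; apply: (@prod_linform_dvd _ l (enum T)); first exact: enum_uniq.
  - by move=> i _; apply: arr.1.
  - by move=> i j; apply: arr_indep.
  - by move=> i; rewrite mem_enum => iT; apply/cross_vanish/hT.
(* [q0] need not be homogeneous; its component of degree one has the same product with [F]. *)
pose q c := pihomog mdeg 1 (q0 c).
have qE c : cross D euler c = q c * F.
  rewrite -[LHS](pihomog_dE (mf := mdeg) (cross_homog c)) q0E mulrC.
  by rewrite (pihomogMr _ hF) ?leq_addr // addKn.
have [||a aE] := @skew_cross q.
- by move=> c; apply: pihomogP.
- apply: (mulfI F0); rewrite mulr0 mulr_sumr.
  rewrite (eq_bigr (fun c => cross D euler c * 'X_c)) => [|c _]; last by rewrite qE; ring.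
  by rewrite big_ord3 !crossE /euler; ring.
have aN : exists k, a k != 0.
  apply: contrapT => /forallNP a0; have [c /eqP] := cross_neq0; apply.
  rewrite qE (_ : q c = 0) ?mul0r //; apply: mpoly_eval0 => v; rewrite aE.
  have {}a0 k : a k = 0 by apply/eqP/negPn/negP/a0.
  by elim/ord3P: c; rewrite !crossE !a0; ring.
have key j : j \notin T -> dot (l j) a = 0.
  move=> jT.
  have : ~ vanish (plane (l j)) F.
    apply: vanish_prod; [exact: plane_closed|by exists (fun=> 0); apply: plane0|].
    move=> i; rewrite mem_enum => iT; apply/vanish_linform/arr_indep => //.
    by apply: contraNneq jT => ->.
  move/existsNP => [v /not_implyP [lv /eqP Fv]].
  have vN : exists k, v k != 0.
    apply: contrapT => /forallNP v0; move: Fv.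
    have -> : F.@[v] = F.@[fun j => 0 * v j].
      by apply: meval_eq => k; rewrite mul0r; apply/eqP/negPn/negP/v0.
    by rewrite (meval_homog _ _ hF) expr0n -[r == 0%N]negbK -lt0n r0 mul0r eqxx.
  pose tau k := evalv D v k - F.@[v] * a k.
  have [|s sE] := @not_indep tau v vN.
    move=> [k /eqP]; apply.
    have -> : cross tau v k = (cross D euler k).@[v] - F.@[v] * cross a v k.
      by rewrite meval_cross /tau; elim/ord3P: k; rewrite !crossE !evalv_euler; ring.
    by rewrite qE mevalM aE; ring.
  have : dot (l j) tau = 0.
    rewrite /dot (eq_bigr (fun k => s * (l j k * v k))); last by move=> k _; rewrite sE; ring.
    by rewrite -mulr_sumr [X in _ * X]lv mulr0.
  have -> : dot (l j) tau = dot (l j) (evalv D v) - F.@[v] * dot (l j) a.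
    by rewrite /dot mulr_sumr -sumrB; apply: eq_bigr => k _; rewrite /tau; ring.
  rewrite -meval_vapp (syz_logder arr sD) // sub0r => /eqP.
  by rewrite oppr_eq0 mulf_eq0 (negbTE Fv) => /eqP.
exists [set m | on_line (l m) a].
  by exists a; split=> // m; rewrite inE.
have -> : (d - r = #|~: T|)%N by rewrite cardsCs setCK card_ord cT.
by apply/subset_leq_card/subsetP => m; rewrite !inE => mT; apply/eqP/key.
Qed.
End Mdr.

(** * Tools for excluding the remaining numerical cases *)

Section Exclusion.
Variables (d : nat) (l : 'I_d -> 'I_3 -> C).
Hypotheses (arr : line_arrangement l) (odt : only_double_triple l).

Lemma npt_le i k : (1 < k)%N -> (npt l i k <= nmult l k)%N.
Proof.
move=> k1; rewrite nmultE // /npt; apply/subset_leq_card/subsetP => B.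
by move/setIdP => [BP /andP[_ Bk]]; apply/setIdP.
Qed.

(** The point found by [mdr_bound] has multiplicity at least [d - r], but at most three, and at most
    two when there are no triple points. *)
Lemma rich_lines r D (A : {set 'I_d}) : (forall c, D c \is r.-homog) -> is_syz (defpoly l) D ->
  (exists c, D c != 0) -> (0 < r)%N -> (0 < d)%N -> (r <= #|A|)%N ->
  (forall i, i \in A -> (r + 2 <= npt l i 2 + npt l i 3)%N) ->
  (d <= r + 3)%N /\ (nmult l 3 = 0 -> (d <= r + 2)%N).
Proof.
move=> hD sD D0 r0 d0 rA hA.
pose T := [set x in take r (enum A)].
have cT : #|T| = r.
  rewrite cardsE (card_uniqP _) ?size_takel -?cardE // take_uniq ?enum_uniq //.
have hT i : i \in T -> (r + 2 <= npt l i 2 + npt l i 3)%N.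
  by rewrite inE => /mem_take; rewrite mem_enum; apply: hA.
have [B eB dB] := mdr_bound arr odt hD sD D0 r0 d0 cT hT.
have B3 := exact_card odt eB; split; first by rewrite -leq_subLR (leq_trans dB).
move=> n3; rewrite -leq_subLR (leq_trans dB) // -ltnS ltn_neqAle B3 andbT.
apply/eqP => cB.
have : B \in [set B : {set 'I_d} in points l | #|B| == 3].
  by apply/setIdP; rewrite cB inE cB; split=> //; apply/asboolP.
by move/eqP: n3; rewrite nmultE // cards_eq0 => /eqP ->; rewrite inE.
Qed.

(** For even [d] each line meets an odd number of others, so [npt_sum] puts a double point on it. *)
Lemma even_double : ~~ odd d -> (0 < d)%N -> (d <= 2 * nmult l 2)%N.
Proof.
move=> od d0; rewrite -(sum_npt l) // -[X in (X <= _)%N]card_ord -sum1_card.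
apply: leq_sum => i _; have := npt_sum arr odt i; case: (npt l i 2) => // h.
by move: od; rewrite -(prednK d0) -h /= add0n mul2n odd_double.
Qed.

Lemma odd_npt i : odd d -> ~~ odd (npt l i 2).
Proof.
move=> od; have d0 : (0 < d)%N by case: (d) od.
have := congr1 odd (npt_sum arr odt i); rewrite oddD mul2n odd_double addbF => ->.
by rewrite -(prednK d0) /= in od.
Qed.

Definition dlines := [set i : 'I_d | (0 < npt l i 2)%N].

Lemma dlines_card M : (forall i, npt l i 2 <= M)%N -> (2 * nmult l 2 <= M * #|dlines|)%N.
Proof.
move=> hM; rewrite -(sum_npt l) // (bigID (mem dlines)) /= [X in (_ + X)%N]big1 => [|i]; last first.
  by rewrite inE lt0n negbK => /eqP.
by rewrite addn0 mulnC -sum_nat_const; apply: leq_sum.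
Qed.
End Exclusion.

(** [a] and [a + m] stand for the first two exponents. After eliminating [n3], the condition
    [n2 >= 0] reads [a^2 + a m + m^2 <= 5 a + 4 m + 3], which forces [m <= 4] and [a <= 5]. *)
Lemma numeric_cases d a m n2 n3 : (0 < a)%N -> d = (a + (a + m))%N ->
  (2 * n3 + a + 3 * (a + m) + 2 = a * a + (a + m) * (a + m))%N ->
  (d * d.-1 = 2 * n2 + 6 * n3)%N ->
  (d, n2, n3) \in MPOG_weak_combinatorics \/
  (d, a, n2, n3) \in [:: (5, 2, 10, 0); (5, 1, 7, 1); (6, 1, 3, 4); (7, 2, 6, 5); (8, 2, 1, 9);
    (9, 3, 3, 11); (10, 5, 3, 14); (10, 4, 3, 14); (11, 5, 1, 18)]%N.
Proof.
move=> a0 dE E3 E2.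
have m4 : (m <= 4)%N by rewrite leqNgt; apply/negP => m5; rewrite dE in E2; nia.
have a5 : (a <= 5)%N by rewrite leqNgt; apply/negP => a6; rewrite dE in E2; nia.
have n3E : n3 = ((a * a + (a + m) * (a + m)) - (a + 3 * (a + m) + 2))./2 by lia.
have n2E : n2 = (d * d.-1 - 6 * n3)./2 by lia.
apply/orP; move: E3 E2 => /eqP + /eqP; rewrite n2E n3E dE.
have : a \in iota 1 5 by rewrite mem_iota; lia.
have : m \in iota 0 5 by rewrite mem_iota; lia.
rewrite !inE => /or4P[||| /orP[]] /eqP -> /or4P[||| /orP[]] /eqP -> //.
Qed.

(** * The classification *)

Section PartOne.
Variables (d : nat) (l : 'I_d -> 'I_3 -> C).
Hypotheses (arr : line_arrangement l) (odt : only_double_triple l).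

Lemma bin2S n : ('C(n.+1 + 2, n.+1) = 'C(n + 2, n) + n.+2)%N.
Proof. by rewrite !addn2 binS binSn addnC. Qed.

Lemma bin2E n : (2 * 'C(n + 2, n) = n.+1 * n.+2)%N.
Proof. elim: n => [//|n IH]; rewrite bin2S mulnDr IH; lia. Qed.

Lemma mpog_numeric (dd : 'I_3 -> nat) : three_syzygy (defpoly l) d dd -> (dd o0 + dd o1 = d)%N ->
  dd o2 = (dd o1).+1 ->
  [/\ (0 < dd o0)%N, (dd o0 <= dd o1)%N,
   (2 * nmult l 3 + dd o0 + 3 * dd o1 + 2 = dd o0 * dd o0 + dd o1 * dd o1)%N &
   exists D : 'I_3 -> S, [/\ forall c, D c \is (dd o0).-homog, is_syz (defpoly l) D & exists c, D c != 0]].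
Proof.
move=> [d1 d12 d23 fmin [r [e [h [kh [hr hsyz hgen rmin [hh hne hmin hker]]]]]]] dsum d3E.
have d0 : (0 < d)%N by lia.
(* [rho] is [e + 1 - d], the common degree of the products of [h j] with [r j]. *)
pose rho := (kh o0 + dd o0)%N.
have hh' j : h j \is (kh j).-homog /\ (rho = kh j + dd j)%N.
  by have [? ?] := hh j; have [_ ?] := hh o0; split=> //; rewrite /rho; lia.
have kdd k : (d + rho <= k)%N -> forall j, (dd j <= k)%N.
  by move=> kk j; have [_] := hh' j; lia.
have main k : (d + rho <= k)%N ->
  (3 * 'C(k + 2, k) + nmult l 3 + 'C(k - rho + 2, k - rho) =
   'C(k - dd o0 + 2, k - dd o0) + 'C(k - dd o1 + 2, k - dd o1) + 'C(k - dd o2 + 2, k - dd o2) + 'C(k - 1 + 2, k - 1) + d * k.+1)%N.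
  move=> kk; have dk : (d <= k)%N by lia.
  have [U1 [h1 e1]] := dim_logder arr odt dk.
  have k0 : (0 < k)%N by lia.
  have krho : (rho <= k)%N by lia.
  have [U2 [h2 e2]] := res_dim arr d0 hr hsyz hgen hh' hne hker k0 (kdd k kk) krho.
  have E : U1 = U2 by apply/vspaceP => th; apply/idP/idP => [/h1/h2|/h2/h1].
  by rewrite -e1 E addnAC e2.
(* Subtracting two consecutive instances of [main] leaves linear terms only, and these give
   [rho = dd o0 + dd o1 + dd o2 + 1 - d]. *)
have rhoE : (rho = dd o1 + 2)%N.
  pose k := (d + rho)%N.
  have m1 := main k (leqnn _); have m2 := main k.+1 (leqnSn _).
  have c0 := kdd k (leqnn _) o0; have c1 := kdd k (leqnn _) o1; have c2 := kdd k (leqnn _) o2.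
  have cr : (rho <= k)%N by rewrite /k; lia.
  have ck : (1 <= k)%N by rewrite /k; lia.
  move: m2; rewrite !subSn // !bin2S.
  move: m1 dsum d3E c0 c1 c2 cr ck; clear.
  move: ('C(_, _)) ('C(_, _)) ('C(_, _)) ('C(_, _)) ('C(_, _)) ('C(_, _)) => b0 b1 b2 b3 b4 b5.
  by move: (nmult l 3) (dd o0) (dd o1) (dd o2) k => n3 a0 a1 a2 k; nia.
split=> //.
  have := main (d + rho)%N (leqnn _); rewrite rhoE d3E.
  have [m mE] : exists m, dd o1 = (dd o0 + m)%N by exists (dd o1 - dd o0)%N; lia.
  have -> : (d + (dd o1 + 2) - (dd o1 + 2) = d)%N by lia.
  have -> : (d + (dd o1 + 2) - dd o0 = dd o1 + dd o1 + 2)%N by lia.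
  have -> : (d + (dd o1 + 2) - dd o1 = d + 2)%N by lia.
  have -> : (d + (dd o1 + 2) - (dd o1).+1 = d + 1)%N by lia.
  have -> : (d + (dd o1 + 2) - 1 = d + dd o1 + 1)%N by lia.
  have := bin2E d; have := bin2E (dd o1 + dd o1 + 2); have := bin2E (d + 2).
  have := bin2E (d + 1); have := bin2E (d + dd o1 + 1); have := bin2E (d + (dd o1 + 2)).
  move: dsum; clear.
  move: ('C(_, _)) ('C(_, _)) ('C(_, _)) ('C(_, _)) ('C(_, _)) ('C(_, _)) => b0 b1 b2 b3 b4 b5.
  by move: (nmult l 3) (dd o0) (dd o1) => n3 a0 a1 <-; nia.
(* Were [r o0] zero, [(1, 0, 0)] would be a relation, hence a multiple of [h]; but [h o0] has no
   constant term, by minimality. *)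
exists (r o0); split=> //.
apply: contrapT => /forallNP r00.
have {}r00 c : r o0 c = 0 by apply/eqP/negPn/negP/r00.
have [t tE] : exists t, forall j, (j == o0)%:R = t * h j.
  apply/hker => c; by rewrite big_ord3 ?eqxx ?ord3_neq r00 mulr0 !mul0r !addr0.
have := congr1 (meval (fun=> 0)) (tE o0); rewrite eqxx meval1 mevalM -(mcoeff0E (h o0)) hmin mulr0.
by move/eqP; rewrite oner_eq0.
Qed.

Lemma part_one : minimal_plus_one_generated (defpoly l) d ->
  (d, nmult l 2, nmult l 3) \in MPOG_weak_combinatorics.
Proof.
move=> [dd [ts dsum d3E]]; have [d10 d12 E3 [D [hD sD D0]]] := mpog_numeric ts dsum d3E.
have E2 := pairs_count arr odt.
have d0 : (0 < d)%N by lia.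
have rich A := @rich_lines d l arr odt _ D A hD sD D0 d10 d0.
have even := even_double arr odt; have oddn := odd_npt arr odt.
have dl := @dlines_card d l; have ple := @npt_le d l; have ps := npt_sum arr odt.
have sA : #|[set: 'I_d]| = d by rewrite cardsT card_ord.
have [m mE] : exists m, dd o1 = (dd o0 + m)%N by exists (dd o1 - dd o0)%N; lia.
rewrite mE in E3 dsum.
set a := dd o0 in rich d10 E3 dsum *.
have hT : (a <= #|[set: 'I_d]|)%N by rewrite sA -dsum leq_addr.
have [//|H] := numeric_cases d10 (esym dsum) E3 E2; exfalso.
have pos i : i \in dlines l = (0 < npt l i 2)%N by rewrite inE.
move: H rich even oddn ple dl; rewrite !inE -!pair_eqE /= => H rich even oddn ple dl.
have ple2 i := ple i 2%N isT; have ple3 i := ple i 3%N isT.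
move: H; do 8? case/orP; move=> /andP[/andP[/andP[/eqP /= ed /eqP /= ea]]] /eqP /= e2 /eqP /= e3.
(* Case (5, 2, 10, 0): every line carries four points and there are no triple points, so
   [d <= 4]. *)
- have h2 i : i \in [set: 'I_d] -> (a + 2 <= npt l i 2 + npt l i 3)%N.
    by move=> _; have := ps i; have := ple3 i; lia.
  by have [_ /(_ e3) h] := rich _ hT h2; lia.
(* Case (5, 1, 7, 1): at most one triple point lies on a line, so every line carries at least three
   points and [d <= 4]. *)
- have h2 i : i \in [set: 'I_d] -> (a + 2 <= npt l i 2 + npt l i 3)%N.
    by move=> _; have := ps i; have := ple3 i; lia.
  by have [h _] := rich _ hT h2; lia.
(* Case (6, 1, 3, 4): five other lines meet a given one in at least three points, so [d <= 4]. *)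
- have h2 i : i \in [set: 'I_d] -> (a + 2 <= npt l i 2 + npt l i 3)%N.
    by move=> _; have := ps i; lia.
  by have [h _] := rich _ hT h2; lia.
(* Case (7, 2, 6, 5): a line with a double point has at least two of them by parity, hence at least
   four points; there are at least [12 / 6 = 2] such lines. *)
- have od : odd d by rewrite ed.
  have h1 : (a <= #|dlines l|)%N.
    have h6 i : (npt l i 2 <= 6)%N by have := ps i; lia.
    by rewrite -(@leq_pmul2l 6) //; apply: leq_trans (dl 6%N h6); rewrite e2 ea.
  have h2 i : i \in dlines l -> (a + 2 <= npt l i 2 + npt l i 3)%N.
    by rewrite pos => h; have := ps i; have := oddn i od; lia.
  by have [h _] := rich _ h1 h2; lia.
(* Case (8, 2, 1, 9): every line would carry a double point, too many for [n_2]. Both cases with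
   [d = 10] fall in the same way. *)
- have ev : ~~ odd d by rewrite ed.
  by have := even ev d0; rewrite e2 ed.
(* Case (9, 3, 3, 11): by parity a line with double points has two of them and three triple points,
   and there are at least [6 / 2 = 3] such lines. *)
- have od : odd d by rewrite ed.
  have h2' i : (npt l i 2 <= 2)%N.
    by have := ple2 i; rewrite e2; have := oddn i od; case: (npt l i 2) => [|[|[|[|]]]].
  have h1 : (a <= #|dlines l|)%N by rewrite -(@leq_pmul2l 2) //; apply: leq_trans (dl 2%N h2'); rewrite e2 ea.
  have h2 i : i \in dlines l -> (a + 2 <= npt l i 2 + npt l i 3)%N.
    by rewrite pos => h; have := ps i; have := oddn i od; lia.
  by have [h _] := rich _ h1 h2; lia.
- have ev : ~~ odd d by rewrite ed.
  by have := even ev d0; rewrite e2 ed.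
- have ev : ~~ odd d by rewrite ed.
  by have := even ev d0; rewrite e2 ed.
(* Case (11, 5, 1, 18): by parity no line can carry the only double point. *)
- have od : odd d by rewrite ed.
  have h0 i : (npt l i 2 <= 0)%N.
    by have := ple2 i; rewrite e2; have := oddn i od; case: (npt l i 2) => [|[|[|[|]]]].
  by have := dl 0%N h0; rewrite e2.
Qed.
End PartOne.

(** * A criterion for plus-one generation *)

(** The two forms generate the ideal of the line [a = m = 0] in C^3: once a variable is eliminated
    by [a], the form [m'] that [m] becomes divides what [Q] becomes. *)
Lemma vanish_line_decomp a m (Q : S) : indep a m -> (exists k, a k != 0) ->
  vanish (fun v => plane a v /\ plane m v) Q -> exists Q', vanish (plane a) (Q - linform m * Q').
Proof.
move=> iam [k ak] hQ; have [p' [pE [q QE]]] := proj3_mpoly Q ak.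
pose m' j := m j - (m k / a k) * a j.
have m'E v : dot m' v = dot m (proj3 a k v).
  rewrite dot_proj3 /dot mulrA mulrAC mulr_sumr -sumrB; apply: eq_bigr => j _; rewrite /m'; ring.
have m'0 : exists j, m' j != 0.
  apply: contrapT => /forallNP m0; have [j /eqP] := iam; apply.
  have [s mE] : exists s, forall i, m i = s * a i.
    by exists (m k / a k) => i; apply/eqP; rewrite -subr_eq0; apply/negPn/negP/m0.
  by elim/ord3P: j; rewrite !crossE !mE; ring.
have [|Q' Q'E] := @vanish_plane_dvd m' p' m'0.
  by move=> v mv; rewrite pE; apply: hQ; split; [apply: plane_proj3|rewrite /plane -m'E].
exists Q' => v av; rewrite mevalB QE mevalD !mevalM Q'E mevalM !meval_linform [dot a v]av m'E dot_proj3 [dot a v]av.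
ring.
Qed.

(** Coprimality modulo [a] in a form that points can certify: [H] is nonzero somewhere on each line
    [a = m = 0], so the factors [m] divide [Q] one after the other. *)
Lemma split_plane a (ms : seq ('I_3 -> C)) (H P Q : S) : (exists k, a k != 0) ->
  (forall i, (i < size ms)%N -> indep a (nth (fun=> 0) ms i) /\
     exists p, [/\ plane a p, plane (nth (fun=> 0) ms i) p & H.@[p] != 0]) ->
  vanish (plane a) (P * \prod_(m <- ms) linform m - Q * H) ->
  exists t, vanish (plane a) (Q - t * \prod_(m <- ms) linform m) /\ vanish (plane a) (P - t * H).
Proof.
move=> a0; elim: ms P Q => [|m ms IH] P Q hms hPQ.
  exists Q; split=> v av; first by rewrite big_nil mulr1 subrr meval0.
  by have := hPQ v av; rewrite big_nil mulr1.
have [iam [p [ap mp Hp]]] := hms 0%N isT.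
have vQ : vanish (fun v => plane a v /\ plane m v) Q.
  apply: (@vanish_prime _ H Q); first by apply: affine_closedI; apply: plane_closed.
    move=> v [av mv]; have := hPQ v av.
    rewrite mevalB !mevalM big_cons mevalM meval_linform [dot m v]mv mul0r mulr0 sub0r => /eqP.
    by rewrite oppr_eq0 mulrC => /eqP.
  by move=> /(_ p (conj ap mp)) /eqP; rewrite (negbTE Hp).
have [Q' hQ'] := vanish_line_decomp iam a0 vQ.
have [||t [t1 t2]] := IH P Q'.
- by move=> i hi; apply: (hms i.+1).
- apply: (@vanish_prime _ (linform m)); [exact: plane_closed| |exact: vanish_linform].
  move=> v av; have := hPQ v av; have := hQ' v av.
  rewrite !(mevalB, mevalM) big_cons mevalM => /eqP; rewrite subr_eq0 => /eqP -> e.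
  by rewrite -[RHS]e; ring.
exists t; split=> // v av; have := t1 v av; have := hQ' v av.
rewrite !(mevalB, mevalM) big_cons mevalM => /eqP; rewrite subr_eq0 => /eqP -> /eqP; rewrite subr_eq0 => /eqP ->.
ring.
Qed.

Definition det3 (x y z : 'I_3 -> S) : S := \sum_c z c * cross x y c.

Lemma det3E x y z : det3 x y z = z o0 * cross x y o0 + z o1 * cross x y o1 + z o2 * cross x y o2.
Proof. exact: big_ord3. Qed.

Lemma syz_lin3 d (l : 'I_d -> 'I_3 -> C) (x y : 'I_3 -> S) (p q t : S) :
  is_syz (defpoly l) x -> is_syz (defpoly l) y ->
  \sum_c (p * x c + q * y c + t * euler c) * mderiv c (defpoly l) = t * (d%:R * defpoly l).
Proof.
rewrite /is_syz => hx hy.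
transitivity (p * (\sum_c x c * mderiv c (defpoly l)) + q * (\sum_c y c * mderiv c (defpoly l)) +
   t * (\sum_c euler c * mderiv c (defpoly l))).
  rewrite mulr_sumr mulr_sumr mulr_sumr -big_split -big_split; apply: eq_bigr => c _ /=.
  by rewrite !mulrDl !mulrA.
by rewrite hx hy syz_euler !mulr0 !add0r.
Qed.

Section Certificate.
Variables (d : nat) (l : 'I_d -> 'I_3 -> C).
Hypotheses (arr : line_arrangement l) (d2 : (1 < d)%N).
Variables (dd : 'I_3 -> nat) (r : 'I_3 -> 'I_3 -> S) (h : 'I_3 -> S) (kh : 'I_3 -> nat) (rho : nat).
Hypotheses (ddP : [/\ (1 <= dd o0)%N, (dd o0 <= dd o1)%N & (dd o1 <= dd o2)%N])
  (hr : forall j c, r j c \is (dd j).-homog)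
  (hsyz : forall j, is_syz (defpoly l) (r j))
  (hh : forall j, [/\ h j \is (kh j).-homog, (0 < kh j)%N & rho = (kh j + dd j)%N])
  (hrel : forall c, \sum_j h j * r j c = 0).
Variables (a : 'I_3 -> C) (kap : C).
Hypotheses (a0 : exists k, a k != 0) (ha : h o2 = linform a) (kap0 : kap != 0)
  (hdet : det3 (r o0) (r o1) euler = kap *: (h o2 * defpoly l)).
Hypothesis hr0 : exists c, ~ vanish (plane a) (r o0 c).
Variables (b b' : 'I_3) (ms : seq ('I_3 -> C)) (w : S).
Hypothesis bb : (b = o0 /\ b' = o1) \/ (b = o1 /\ b' = o0).
Hypothesis hb : h b = \prod_(m <- ms) linform m + h o2 * w.
Hypothesis hms : forall i, (i < size ms)%N -> indep a (nth (fun=> 0) ms i) /\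
     exists p, [/\ plane a p, plane (nth (fun=> 0) ms i) p & (h b').@[p] != 0].
Hypothesis hb' : ~ vanish (plane a) (h b').

Let f0 : defpoly l != 0. Proof. exact: defpoly_neq0. Qed.

Lemma cert_h2 : h o2 != 0.
Proof.
rewrite ha; apply/eqP => e; have [k ak] := a0.
by have := congr1 (meval (bvec k)) e; rewrite meval_linform dot_bvec meval0 => /eqP; rewrite (negbTE ak).
Qed.

(** The determinant of [hdet] is nonzero, hence so is some minor of the pair [r o0], [r o1]. *)
Lemma cert_indep (x y : S) : (forall c, x * r o0 c + y * r o1 c = 0) -> x = 0 /\ y = 0.
Proof.
move=> e.
have [c cN] : exists c, cross (r o0) (r o1) c != 0.
  apply: contrapT => /forallNP n0.
  have : det3 (r o0) (r o1) euler != 0 by rewrite hdet scaler_eq0 (negbTE kap0) mulf_neq0 ?cert_h2.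
  by rewrite /det3 big1 ?eqxx // => c _; have /negP/negPn/eqP -> := n0 c; rewrite mulr0.
have ex : x * cross (r o0) (r o1) c = 0.
  elim/ord3P: c {cN}; rewrite !crossE.
  - have -> : x * (r o0 o1 * r o1 o2 - r o0 o2 * r o1 o1) = (x * r o0 o1 + y * r o1 o1) * r o1 o2 - (x * r o0 o2 + y * r o1 o2) * r o1 o1 by ring.
    by rewrite !e; ring.
  - have -> : x * (r o0 o2 * r o1 o0 - r o0 o0 * r o1 o2) = (x * r o0 o2 + y * r o1 o2) * r o1 o0 - (x * r o0 o0 + y * r o1 o0) * r o1 o2 by ring.
    by rewrite !e; ring.
  - have -> : x * (r o0 o0 * r o1 o1 - r o0 o1 * r o1 o0) = (x * r o0 o0 + y * r o1 o0) * r o1 o1 - (x * r o0 o1 + y * r o1 o1) * r o1 o0 by ring.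
    by rewrite !e; ring.
have x0 : x = 0 by move/eqP: ex; rewrite mulf_eq0 (negbTE cN) orbF => /eqP.
split=> //; have ey : y * cross (r o0) (r o1) c = 0.
  have {}e c' : y * r o1 c' = 0 by have := e c'; rewrite x0 mul0r add0r.
  elim/ord3P: c {cN ex}; rewrite !crossE mulrBr ![y * (_ * _)]mulrCA !e; ring.
by move/eqP: ey; rewrite mulf_eq0 (negbTE cN) orbF => /eqP.
Qed.

(** Eliminating [r o2] between [g] and [h] gives a relation of [r o0] and [r o1], so [g] and [h] are
    proportional; [h o2] divides [g o2] because [h b'] is nonzero modulo [h o2]. *)
Lemma cert_kernel (g : 'I_3 -> S) :
  (forall c, \sum_j g j * r j c = 0) <-> (exists t : S, forall j, g j = t * h j).
Proof.
split=> [e|[t tE] c]; last first.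
  by rewrite (eq_bigr (fun j => t * (h j * r j c))) => [|j _]; rewrite ?tE ?mulrA // -mulr_sumr hrel mulr0.
have [|e0 e1] := @cert_indep (g o0 * h o2 - g o2 * h o0) (g o1 * h o2 - g o2 * h o1).
  move=> c; have := e c; have := hrel c; rewrite !big_ord3 => h1 h2.
  have -> : (g o0 * h o2 - g o2 * h o0) * r o0 c + (g o1 * h o2 - g o2 * h o1) * r o1 c =
    h o2 * (g o0 * r o0 c + g o1 * r o1 c + g o2 * r o2 c) - g o2 * (h o0 * r o0 c + h o1 * r o1 c + h o2 * r o2 c) by ring.
  by rewrite h1 h2; ring.
move/eqP: e0; rewrite subr_eq0 => /eqP e0; move/eqP: e1; rewrite subr_eq0 => /eqP e1.
have vg : vanish (plane a) (g o2).
  apply: (@vanish_prime _ (h b')) => //; first exact: plane_closed.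
  move=> v av; rewrite mulrC; case: bb => -[_ ->].
    by rewrite -e1 mevalM ha meval_linform [dot a v]av mulr0.
  by rewrite -e0 mevalM ha meval_linform [dot a v]av mulr0.
have [t tE] := vanish_plane_dvd a0 vg.
have H2 := cert_h2; rewrite -ha in tE; exists t; apply: ord3P; last by rewrite tE mulrC.
  by apply: (mulIf H2); rewrite e0 tE; ring.
by apply: (mulIf H2); rewrite e1 tE; ring.
Qed.

(** At each point of the plane of a line, the two fields and the Euler field take values in that
    plane. *)
Lemma det_dvd x y : logder l x -> logder l y -> exists q, det3 x y euler = defpoly l * q.
Proof.
move=> lx ly; apply: prod_linform_dvd; first exact: index_enum_uniq.
- by move=> i _; apply: arr.1.
- by move=> i j; apply: arr_indep.
- move=> i _ v lv; rewrite /det3 raddf_sum /=.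
  rewrite (eq_bigr (fun c => v c * cross (evalv x v) (evalv y v) c)); last first.
    by move=> c _; rewrite mevalM meval_cross mevalXU.
  apply: (plane_cross (arr.1 i)) => //; rewrite /plane -meval_vapp; [exact: lx|exact: ly].
Qed.

Lemma det_cramer x y z s c :
  det3 x y z * s c = det3 s y z * x c + det3 x s z * y c + det3 x y s * z c.
Proof.
rewrite !det3E; elim/ord3P: c; rewrite !crossE.
all: move: (x o0) (x o1) (x o2) (y o0) (y o1) (y o2) (z o0) (z o1) (z o2) (s o0) (s o1) (s o2).
all: move=> x0 x1 x2 y0 y1 y2 z0 z1 z2 s0 s1 s2; ring.
Qed.

(* Cramer's rule writes [h_2 s] as [u r_0 + v r_1]; modulo [h_2] the pair [(u, v)]
   is proportional to [(h_0, h_1)] by coprimality, and [h_0 r_0 + h_1 r_1 = - h_2 r_2]. *)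
Lemma cert_gen s : is_syz (defpoly l) s -> exists g : 'I_3 -> S, forall c, s c = \sum_(j < 3) g j * r j c.
Proof.
move=> hs; have ls := syz_logder arr hs; have l0 := syz_logder arr (hsyz o0); have l1 := syz_logder arr (hsyz o1).
have [U UE] := det_dvd ls l1; have [V VE] := det_dvd l0 ls.
(* Cramer's identity, applied to [f] as an identity of derivations, kills the syzygies and leaves
   the product of this determinant with [d f]. *)
have ds : det3 (r o0) (r o1) s = 0.
  have : \sum_c (det3 s (r o1) euler * r o0 c + det3 (r o0) s euler * r o1 c + det3 (r o0) (r o1) s * euler c) * mderiv c (defpoly l) = 0.
    rewrite (eq_bigr (fun c => det3 (r o0) (r o1) euler * (s c * mderiv c (defpoly l)))); last first.
      by move=> c _; rewrite -det_cramer mulrA.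
    by rewrite -mulr_sumr [X in _ * X]hs mulr0.
  rewrite syz_lin3 //.
  move/eqP; rewrite !mulf_eq0 (negbTE f0) orbF => /orP[/eqP //|].
  rewrite -mpolyC_nat mpolyC_eq0 pnatr_eq0 => /eqP dz.
  by move: (d2); rewrite {1}dz.
pose u := kap^-1 *: U; pose v := kap^-1 *: V.
have sE c : h o2 * s c = u * r o0 c + v * r o1 c.
  apply: (mulIf f0); have := det_cramer (r o0) (r o1) euler s c.
  rewrite hdet UE VE ds mul0r addr0 => e.
  have := congr1 ( *:%R kap^-1) e; rewrite -scalerAl scalerA mulVf // scale1r => e'.
  rewrite mulrAC e' /u /v -!mul_mpolyC; ring.
have [c0 rc0] := hr0.
(* Modulo [h o2], both [(u, v)] and [(h o0, h o1)] are relations of [r o0] and [r o1]; as [r o0] is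
   nonzero there, the two pairs are proportional. *)
have vuv : vanish (plane a) (u * h o1 - v * h o0).
  apply: (@vanish_prime _ (r o0 c0)) => //; first exact: plane_closed.
  move=> p ap; have e1 := congr1 (meval p) (sE c0); have e2 := congr1 (meval p) (hrel c0).
  move: e1 e2; rewrite big_ord3 ha !(mevalM, mevalD, mevalB, mevalN) meval_linform [dot a p]ap meval0 mul0r => e1 e2.
  have -> : (r o0 c0).@[p] * (u.@[p] * (h o1).@[p] - v.@[p] * (h o0).@[p]) =
     (h o1).@[p] * (u.@[p] * (r o0 c0).@[p] + v.@[p] * (r o1 c0).@[p]) -
     v.@[p] * ((h o0).@[p] * (r o0 c0).@[p] + (h o1).@[p] * (r o1 c0).@[p] + 0 * (r o2 c0).@[p]) by ring.
  by rewrite -e1 e2; ring.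
have [t [tu tv]] : exists t, vanish (plane a) (u - t * h o0) /\ vanish (plane a) (v - t * h o1).
  have hbp p : plane a p -> (h b).@[p] = (\prod_(m <- ms) linform m).@[p].
    by move=> ap; rewrite hb mevalD mevalM ha meval_linform [dot a p]ap mul0r addr0.
  case: bb => -[eb eb']; move: hbp (hms); rewrite eb eb' => hbp hms'.
    have [|t [t1 t2]] := @split_plane a ms (h o1) v u a0 hms'.
      move=> p ap; have := vuv p ap; rewrite !(mevalB, mevalM) -hbp // => e.
      by rewrite -[RHS]oppr0 -e; ring.
    exists t; split=> // p ap; have := t1 p ap; rewrite !(mevalB, mevalM) -hbp //.
  have [|t [t1 t2]] := @split_plane a ms (h o0) u v a0 hms'.
    by move=> p ap; have := vuv p ap; rewrite !(mevalB, mevalM) -hbp.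
  exists t; split=> // p ap; have := t1 p ap; rewrite !(mevalB, mevalM) -hbp //.
have [al alE] := vanish_plane_dvd a0 tu; have [be beE] := vanish_plane_dvd a0 tv.
rewrite -ha in alE beE.
exists (fun j => if j == o0 then al else if j == o1 then be else - t) => c.
apply: (mulfI cert_h2); rewrite sE big_ord3 eqxx !ord3_neq eqxx.
have -> : u = t * h o0 + h o2 * al by rewrite -alE; ring.
have -> : v = t * h o1 + h o2 * be by rewrite -beE; ring.
have := hrel c; rewrite big_ord3 => /eqP; rewrite addr_eq0 => /eqP e.
have -> : (t * h o0 + h o2 * al) * r o0 c + (t * h o1 + h o2 * be) * r o1 c =
  t * (h o0 * r o0 c + h o1 * r o1 c) + h o2 * (al * r o0 c + be * r o1 c) by ring.
rewrite e; ring.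
Qed.

Lemma homog_max_ideal k (p : S) : p \is k.-homog -> (0 < k)%N -> in_max_ideal p.
Proof. by move=> hp k0; rewrite /in_max_ideal (dhomog_nemf_coeff hp) //= mdeg0 eq_sym -lt0n. Qed.

Lemma cert_three_syzygy : three_syzygy (defpoly l) d dd.
Proof.
have [dd0 dd01 dd12] := ddP.
have hf : defpoly l \is d.-homog.
  rewrite /defpoly -big_enum /=; have := homog_prodlin l (enum 'I_d); by rewrite size_enum_ord.
split=> // [k|].
  rewrite /in_max_ideal mcoeff_mderiv add0m (dhomog_nemf_coeff hf) ?mul0rn // /= mdeg1.
  by rewrite neq_ltn d2.
exists r, (rho + d - 1)%N, h, kh; split=> //.
- exact: cert_gen.
- by move=> j c; apply: (homog_max_ideal (hr j c)); elim/ord3P: j; lia.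
split=> //.
- move=> j; have [hj k0 e] := hh j; split=> //; lia.
- by exists o2; apply: cert_h2.
- by move=> j; have [hj k0 e] := hh j; apply: homog_max_ideal hj k0.
- exact: cert_kernel.
Qed.
End Certificate.

(** * Certificates *)

Notation Z := BinNums.Z.
Definition mon := (nat * nat * nat)%type.
Definition zvec := (Z * Z * Z)%type.
(** Sparse integer polynomials for evaluation by [vm_compute]. Terms with coefficient zero may
    remain, so [szero] tests the coefficients and not emptiness. *)
Definition spoly := seq (Z * mon).

Definition zC (z : Z) : C := (int_of_Z z)%:~R.

Lemma zCD x y : zC (BinInt.Z.add x y) = zC x + zC y.
Proof. by rewrite /zC -[BinInt.Z.add x y]/(x + y) rmorphD /= intrD. Qed.

Lemma zCM x y : zC (BinInt.Z.mul x y) = zC x * zC y.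
Proof. by rewrite /zC -[BinInt.Z.mul x y]/(x * y) rmorphM /= intrM. Qed.

Lemma zCN x : zC (BinInt.Z.opp x) = - zC x.
Proof. by rewrite /zC -[BinInt.Z.opp x]/(- x) rmorphN /= intrN. Qed.

Lemma zC_eq0 x : (zC x == 0) = BinInt.Z.eqb x BinNums.Z0.
Proof.
by rewrite /zC intr_eq0; case: x => [|p|p] //=; apply/eqP; have := Pnat.Pos2Nat.is_pos p; lia.
Qed.

Definition evm (m : mon) : S := 'X_o0 ^+ m.1.1 * 'X_o1 ^+ m.1.2 * 'X_o2 ^+ m.2.
Definition ev (p : spoly) : S := \sum_(t <- p) zC t.1 *: evm t.2.

Fixpoint sins (c : Z) (m : mon) (p : spoly) : spoly :=
  match p with
  | [::] => [:: (c, m)]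
  | t :: p' => if t.2 == m then (BinInt.Z.add t.1 c, m) :: p' else t :: sins c m p'
  end.
Definition sadd (p q : spoly) := foldr (fun t acc => sins t.1 t.2 acc) q p.
Definition mmul (m n : mon) : mon := (m.1.1 + n.1.1, m.1.2 + n.1.2, m.2 + n.2)%N.
Definition stmul (c : Z) (m : mon) (p : spoly) : spoly :=
  [seq (BinInt.Z.mul c t.1, mmul m t.2) | t <- p].
Definition smul (p q : spoly) := foldr (fun t acc => sadd (stmul t.1 t.2 q) acc) [::] p.
Definition sscale (c : Z) (p : spoly) : spoly := [seq (BinInt.Z.mul c t.1, t.2) | t <- p].
Definition ssub p q := sadd (sscale (BinInt.Z.opp (BinNums.Zpos BinNums.xH)) q) p.
Definition szero (p : spoly) := all (fun t => BinInt.Z.eqb t.1 BinNums.Z0) p.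
Definition zlin (v : zvec) : spoly := [:: (v.1.1, (1, 0, 0)); (v.1.2, (0, 1, 0)); (v.2, (0, 0, 1))]%N.
Definition sprod (s : seq zvec) : spoly :=
  foldr (fun v acc => smul (zlin v) acc) [:: (BinNums.Zpos BinNums.xH, (0, 0, 0)%N)] s.
Definition shomog (k : nat) (p : spoly) := all (fun t => t.2.1.1 + t.2.1.2 + t.2.2 == k)%N p.

Definition tri {A} (t : A * A * A) (k : 'I_3) : A :=
  if k == o0 then t.1.1 else if k == o1 then t.1.2 else t.2.

Lemma triE A (t : A * A * A) : (tri t o0 = t.1.1) * (tri t o1 = t.1.2) * (tri t o2 = t.2).
Proof. by rewrite /tri !eqxx !ord3_neq. Qed.

Definition sder0 (p : spoly) : spoly :=
  [seq (BinInt.Z.mul (BinInt.Z.of_nat t.2.1.1) t.1, (t.2.1.1.-1, t.2.1.2, t.2.2)) | t <- p].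
Definition sder1 (p : spoly) : spoly :=
  [seq (BinInt.Z.mul (BinInt.Z.of_nat t.2.1.2) t.1, (t.2.1.1, t.2.1.2.-1, t.2.2)) | t <- p].
Definition sder2 (p : spoly) : spoly :=
  [seq (BinInt.Z.mul (BinInt.Z.of_nat t.2.2) t.1, (t.2.1.1, t.2.1.2, t.2.2.-1)) | t <- p].

Definition zpow (x : Z) (n : nat) : Z := iter n (BinInt.Z.mul x) (BinNums.Zpos BinNums.xH).
Definition seval (p : spoly) (v : zvec) : Z :=
  foldr (fun t acc => BinInt.Z.add (BinInt.Z.mul t.1 (BinInt.Z.mul (BinInt.Z.mul (zpow v.1.1 t.2.1.1) (zpow v.1.2 t.2.1.2)) (zpow v.2 t.2.2))) acc) BinNums.Z0 p.

Definition zvC (v : zvec) : 'I_3 -> C := fun k => zC (tri v k).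

Lemma ev_nil : ev [::] = 0. Proof. exact: big_nil. Qed.
Lemma ev_cons t p : ev (t :: p) = zC t.1 *: evm t.2 + ev p. Proof. exact: big_cons. Qed.

Lemma ev_sins c m p : ev (sins c m p) = zC c *: evm m + ev p.
Proof.
elim: p => [|t p IH] /=; first by rewrite ev_cons.
case: eqP => [<-|_]; rewrite !ev_cons /=; first by rewrite zCD scalerDl addrAC addrC.
by rewrite IH addrCA.
Qed.

Lemma ev_add p q : ev (sadd p q) = ev p + ev q.
Proof. by elim: p => [|t p IH] /=; rewrite ?ev_nil ?add0r // ev_sins IH ev_cons addrA. Qed.

Lemma evm_mul m n : evm (mmul m n) = evm m * evm n.
Proof. by rewrite /evm /= !exprD; move: ('X_o0 ^+ _) ('X_o0 ^+ _) ('X_o1 ^+ _) ('X_o1 ^+ _) ('X_o2 ^+ _) ('X_o2 ^+ _) => *; ring. Qed.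

Lemma ev_tmul c m p : ev (stmul c m p) = zC c *: (evm m * ev p).
Proof.
rewrite /ev /stmul big_map mulr_sumr scaler_sumr; apply: eq_bigr => t _ /=.
by rewrite zCM evm_mul -scalerAr scalerA.
Qed.

Lemma ev_mul p q : ev (smul p q) = ev p * ev q.
Proof.
elim: p => [|t p IH] /=; first by rewrite ev_nil mul0r.
by rewrite ev_add ev_tmul IH ev_cons mulrDl scalerAl.
Qed.

Lemma ev_scale c p : ev (sscale c p) = zC c *: ev p.
Proof.
rewrite /ev /sscale big_map scaler_sumr; apply: eq_bigr => t _ /=.
by rewrite zCM scalerA.
Qed.

Lemma ev_sub p q : ev (ssub p q) = ev p - ev q.
Proof. by rewrite /ssub ev_add ev_scale zCN scaleNr scale1r addrC. Qed.

Lemma ev_zero p : szero p -> ev p = 0.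
Proof.
elim: p => [|t p IH] /=; first by rewrite ev_nil.
by rewrite ev_cons -zC_eq0 => /andP[/eqP -> /IH ->]; rewrite scale0r addr0.
Qed.

Lemma ev_lin v : ev (zlin v) = linform (zvC v).
Proof.
rewrite /zlin !ev_cons ev_nil addr0 /linform big_ord3 /zvC !triE /evm /=.
by rewrite !expr0 !expr1 !mulr1 !mul1r addrA.
Qed.

Lemma ev_prod s : ev (sprod s) = \prod_(v <- s) linform (zvC v).
Proof.
elim: s => [|v s IH]; last by rewrite big_cons -IH -ev_lin -ev_mul.
by rewrite big_nil /sprod /= ev_cons ev_nil addr0 /evm /= !expr0 !mulr1 scale1r.
Qed.

Lemma ev_homog k p : shomog k p -> ev p \is k.-homog.
Proof.
elim: p => [|t p IH] /=; first by rewrite ev_nil rpred0.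
move=> /andP[/eqP tk /IH h]; rewrite ev_cons rpredD //; apply: rpredZ; rewrite -tk.
have hX (j : 'I_3) e : ('X_j ^+ e : S) \is e.-homog.
  have hj : ('X_j : S) \is 1.-homog by rewrite dhomogX /= mdeg1.
  by have := dhomogMn e hj; rewrite mul1n.
by do !apply: dhomogM.
Qed.

Lemma zC_nat n : zC (BinInt.Z.of_nat n) = n%:R.
Proof.
elim: n => [//|n IH].
by rewrite Znat.Nat2Z.inj_succ -BinInt.Z.add_1_r zCD IH -natr1.
Qed.

Lemma mderivXn (i j : 'I_3) n : mderiv i ('X_j ^+ n : S) = (i == j)%:R *: (n%:R *: 'X_j ^+ n.-1).
Proof.
have d1 : mderiv i ('X_j : S) = ((i == j)%:R : C)%:MP.
  rewrite mderivX mnmE eq_sym; case: (eqVneq i j) => [->|ij]; last by rewrite scale0r mpolyC0.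
  rewrite scale1r (_ : (U_(j) - U_(j))%MM = 0%MM) ?mpolyX0 ?mpolyC1 //.
  by apply/mnmP => x; rewrite !mnmE subnn.
elim: n => [|n IH]; first by rewrite expr0 -mpolyC1 mderivC scale0r scaler0.
rewrite exprS mderivM d1 mul_mpolyC IH -!scalerAr; case: n {IH} => [|n].
  by rewrite !expr0 !scale0r !scaler0 addr0 scale1r.
by rewrite /= -exprS -scalerDr; congr (_ *: _); rewrite -[n.+2%:R]natr1 scalerDl scale1r addrC.
Qed.

Lemma ev_der k p : mderiv k (ev p) = ev (tri (sder0 p, sder1 p, sder2 p) k).
Proof.
elim: p => [|t p IH].
  by rewrite ev_nil linear0 /= /tri; case: ifP => _; [|case: ifP => _]; rewrite ev_nil.
rewrite ev_cons linearD /= {}IH mderivZ; case: t => c [[a b] e]; rewrite /evm /= !mderivM !mderivXn.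
elim/ord3P: k; rewrite !triE ?eqxx !ord3_neq /= !ev_cons /evm /= zCM zC_nat.
all: move: ('X_o0 ^+ a) ('X_o0 ^+ a.-1) ('X_o1 ^+ b) ('X_o1 ^+ b.-1) ('X_o2 ^+ e) ('X_o2 ^+ e.-1).
all: move=> x x' y y' z z'; congr (_ + _); rewrite -!mul_mpolyC mpolyC0 mpolyC1 mpolyCM; ring.
Qed.

Lemma zC_pow x n : zC (zpow x n) = zC x ^+ n.
Proof. by elim: n => [|n IH] //=; rewrite zCM IH exprS. Qed.

Lemma ev_eval p v : (ev p).@[zvC v] = zC (seval p v).
Proof.
elim: p => [|t p IH] /=; first by rewrite ev_nil meval0.
by rewrite ev_cons mevalD mevalZ zCD !zCM IH !mevalM !rmorphXn /= !mevalXU /zvC !triE !zC_pow.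
Qed.

Definition zdot (u v : zvec) : Z :=
  BinInt.Z.add (BinInt.Z.add (BinInt.Z.mul u.1.1 v.1.1) (BinInt.Z.mul u.1.2 v.1.2)) (BinInt.Z.mul u.2 v.2).
Definition zsub x y := BinInt.Z.add x (BinInt.Z.opp y).
Definition zcross (u v : zvec) : zvec :=
  (zsub (BinInt.Z.mul u.1.2 v.2) (BinInt.Z.mul u.2 v.1.2),
   zsub (BinInt.Z.mul u.2 v.1.1) (BinInt.Z.mul u.1.1 v.2),
   zsub (BinInt.Z.mul u.1.1 v.1.2) (BinInt.Z.mul u.1.2 v.1.1)).
Definition zis0 (x : Z) := BinInt.Z.eqb x BinNums.Z0.
Definition znz (v : zvec) := ~~ [&& zis0 v.1.1, zis0 v.1.2 & zis0 v.2].

Lemma zC_is0 x : (zC x == 0) = zis0 x. Proof. exact: zC_eq0. Qed.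

Lemma zC_dot u v : dot (zvC u) (zvC v) = zC (zdot u v).
Proof. by rewrite /dot big_ord3 /zvC !triE !zCD !zCM. Qed.

Lemma zC_cross u v k : zvC (zcross u v) k = cross (zvC u) (zvC v) k.
Proof. by elim/ord3P: k; rewrite !crossE /zvC !triE /= zCD zCN !zCM. Qed.

Lemma znzP v : znz v -> exists k, zvC v k != 0.
Proof.
rewrite /znz !negb_and /zvC => /or3P[] h; [exists o0|exists o1|exists o2];
  by rewrite triE zC_is0.
Qed.

Lemma zcrossP u v : znz (zcross u v) -> indep (zvC u) (zvC v).
Proof. by move/znzP => [k]; rewrite zC_cross; exists k. Qed.

Definition spoly3 := (spoly * spoly * spoly)%type.

Definition sdot (x y : spoly3) : spoly :=
  sadd (sadd (smul x.1.1 y.1.1) (smul x.1.2 y.1.2)) (smul x.2 y.2).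
Definition scross (x y : spoly3) : spoly3 :=
  (ssub (smul x.1.2 y.2) (smul x.2 y.1.2), ssub (smul x.2 y.1.1) (smul x.1.1 y.2),
   ssub (smul x.1.1 y.1.2) (smul x.1.2 y.1.1)).
Definition sX : spoly3 := let o := BinNums.Zpos BinNums.xH in
  ([:: (o, (1, 0, 0))], [:: (o, (0, 1, 0))], [:: (o, (0, 0, 1))])%N.
Definition shomog3 k (x : spoly3) := [&& shomog k x.1.1, shomog k x.1.2 & shomog k x.2].
Definition sgrad (p : spoly) : spoly3 := (sder0 p, sder1 p, sder2 p).
(** Transposition: the relation among the syzygies is checked one coordinate at a time. *)
Definition col (x : spoly3 * spoly3 * spoly3) : spoly3 * spoly3 * spoly3 :=
  ((x.1.1.1.1, x.1.2.1.1, x.2.1.1), (x.1.1.1.2, x.1.2.1.2, x.2.1.2), (x.1.1.2, x.1.2.2, x.2.2)).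

Definition ev3 (x : spoly3) : 'I_3 -> S := fun k => ev (tri x k).

Lemma ev_dot x y : ev (sdot x y) = \sum_k ev3 x k * ev3 y k.
Proof. by rewrite big_ord3 /ev3 !triE !ev_add !ev_mul. Qed.

Lemma ev_cross x y k : ev3 (scross x y) k = cross (ev3 x) (ev3 y) k.
Proof. by elim/ord3P: k; rewrite !crossE /ev3 !triE /= ev_sub !ev_mul. Qed.

Lemma ev_X k : ev3 sX k = euler k.
Proof.
by elim/ord3P: k; rewrite /ev3 triE /= ev_cons ev_nil addr0 /evm /= !expr0 !expr1 ?mulr1 ?mul1r scale1r.
Qed.

(* [crel] is [(h_0, h_1)] and [cform] the linear form [h_2]; [ckappa = (p, q)] means
   [q det (r_0, r_1, E) = p h_2 f].  Either [h_0] (if [cfirst]) or [h_1] is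
   [h_2 crest] plus the product of the forms in [csplit], each paired with a point of
   its intersection with [h_2 = 0] where the other one of [h_0, h_1] does not vanish.
   At [cpoint], on [h_2 = 0], the syzygy [r_0] does not vanish. *)
Record certificate := Certificate {
  clines : seq zvec; csyz : spoly3 * spoly3 * spoly3; crel : spoly * spoly; cform : zvec;
  cfirst : bool; ckappa : Z * Z; csplit : seq (zvec * zvec); crest : spoly; cpoint : zvec }.

Section Check.
Variables (d : nat) (dd : nat * nat * nat) (K : certificate).
Let L := clines K.
Let r0 := (csyz K).1.1.
Let r1 := (csyz K).1.2.
Let r2 := (csyz K).2.
Let h0 := (crel K).1.
Let h1 := (crel K).2.
Let h2 := zlin (cform K).
Let nthL i := nth (BinNums.Z0, BinNums.Z0, BinNums.Z0) L i.

(** For distinct lines [i] and [j] the count is the multiplicity of their intersection point. *)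
Definition check_lines :=
  (size L == d) && all (fun i => all (fun j => (i == j) ||
     (znz (zcross (nthL i) (nthL j)) && (count (fun t => zis0 (zdot t (zcross (nthL i) (nthL j)))) L <= 3)%N))
       (iota 0 d)) (iota 0 d).

(** The relation has total degree [dd.2.+1] because [h2] is linear, and this fixes the degrees of
    [h0] and [h1]. *)
Definition check_degrees := [&& (1 < d)%N, (1 <= dd.1.1)%N, (dd.1.1 <= dd.1.2)%N,
  (dd.1.1 + dd.1.2 == d)%N, dd.2 == dd.1.2.+1,
  shomog3 dd.1.1 r0, shomog3 dd.1.2 r1, shomog3 dd.2 r2,
  shomog (dd.2.+1 - dd.1.1) h0 & shomog (dd.2.+1 - dd.1.2) h1].

Definition check_syzygies := let F := sprod L in let G := sgrad F in
  [&& szero (sdot r0 G), szero (sdot r1 G), szero (sdot r2 G),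
      szero (sdot (h0, h1, h2) (col (csyz K)).1.1), szero (sdot (h0, h1, h2) (col (csyz K)).1.2),
      szero (sdot (h0, h1, h2) (col (csyz K)).2),
      ~~ zis0 (ckappa K).1, ~~ zis0 (ckappa K).2 &
      szero (ssub (sscale (ckappa K).2 (sdot sX (scross r0 r1))) (sscale (ckappa K).1 (smul h2 F)))].

(** A nonempty [csplit] also yields a point of the plane where [hb'] is nonzero, as [cert_kernel]
    requires. *)
Definition check_split := let hb := if cfirst K then h0 else h1 in let hb' := if cfirst K then h1 else h0 in
  [&& znz (cform K), zis0 (zdot (cform K) (cpoint K)),
      ~~ [&& zis0 (seval r0.1.1 (cpoint K)), zis0 (seval r0.1.2 (cpoint K)) & zis0 (seval r0.2 (cpoint K))],
      szero (ssub hb (sadd (sprod (map fst (csplit K))) (smul h2 (crest K)))),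
      (0 < size (csplit K))%N &
      all (fun mp => [&& znz (zcross (cform K) mp.1), zis0 (zdot (cform K) mp.2), zis0 (zdot mp.1 mp.2) &
         ~~ zis0 (seval hb' mp.2)]) (csplit K)].

Definition check := [&& check_lines, check_degrees, check_syzygies & check_split].

Definition realized := exists lR : 'I_d -> 'I_3 -> R, let l := fun i k => RtoC (lR i k) in
  [/\ line_arrangement l, only_double_triple l & minimal_plus_one_generated (defpoly l) d].

Let l (i : 'I_d) : 'I_3 -> C := zvC (nthL i).

Lemma check_arrangement : (1 < d)%N -> check_lines -> line_arrangement l /\ only_double_triple l.
Proof.
move=> d1 /andP[/eqP sL /allP hL].
have pair (i j : 'I_d) : i != j -> indep (l i) (l j) /\
    (count (fun t => zis0 (zdot t (zcross (nthL i) (nthL j)))) L <= 3)%N.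
  move=> ij; have iI : (i : nat) \in iota 0 d by rewrite mem_iota /= ltn_ord.
  have jI : (j : nat) \in iota 0 d by rewrite mem_iota /= ltn_ord.
  have /allP /(_ _ jI) := hL _ iI.
  by rewrite val_eqE (negbTE ij) /= => /andP[/zcrossP].
have lin_nz u v : indep u v -> exists k, u k != 0.
  move=> [k nk]; apply: contrapT => /forallNP u0.
  have {}u0 j : u j = 0 by apply/eqP/negPn/negP/u0.
  by move: nk; elim/ord3P: k; rewrite !crossE !u0 !mul0r subrr eqxx.
have arr : line_arrangement l.
  split=> [i|i j ij [c cE]].
    (* A line has a nonzero equation because it is independent of another one, which exists since
       [d > 1]. *)
    have [j ij] : exists j, i != j.
      have [e|ne] := eqVneq i (Ordinal d1); last by exists (Ordinal d1).
      by exists (Ordinal (ltnW d1)); rewrite e -val_eqE.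
    by have [/lin_nz] := pair i j ij.
  have [[k /eqP nk] _] := pair i j ij; apply: nk.
  by elim/ord3P: k; rewrite !crossE !cE; ring.
split=> // k k4; apply/eqP; rewrite cards_eq0 -subset0; apply/subsetP => B.
rewrite inE => /andP[/eqP Bk /asboolP eB].
have B1 : (1 < #|B|)%N by rewrite Bk; lia.
have [i [j [iB jB ij]]] := card_gt1P B1.
have BE := exact_meetset arr eB iB jB ij.
have [_ c3] := pair i j ij.
suff : (#|B| <= 3)%N by rewrite Bk leqNgt k4.
rewrite BE (leq_trans _ c3) // -sum1_count (big_nth (BinNums.Z0, BinNums.Z0, BinNums.Z0)) big_mkord sL.
rewrite -sum1dep_card; apply: eq_leq; apply: eq_bigl => m.
rewrite /conc -zC_is0 -zC_dot /l /dot; congr (_ == 0).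
by apply: eq_bigr => c _; rewrite zC_cross.
Qed.

Lemma sprod_defpoly : size L = d -> ev (sprod L) = defpoly l.
Proof.
move=> sL; rewrite ev_prod (big_nth (BinNums.Z0, BinNums.Z0, BinNums.Z0)) sL big_mkord.
by [].
Qed.

Lemma szero_dot x y : szero (sdot x y) -> \sum_k ev3 x k * ev3 y k = 0.
Proof. by move/ev_zero; rewrite ev_dot. Qed.

Lemma zis0_plane u v : zis0 (zdot u v) -> plane (zvC u) (zvC v).
Proof. by move=> h; rewrite /plane zC_dot; apply/eqP; rewrite zC_is0. Qed.

Lemma not_vanish_eval u v p : zis0 (zdot u v) -> ~~ zis0 (seval p v) -> ~ vanish (plane (zvC u)) (ev p).
Proof.
by move=> /zis0_plane uv pv /(_ _ uv); rewrite ev_eval => /eqP; rewrite zC_is0 (negbTE pv).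
Qed.

Lemma check_three_syzygy : check -> three_syzygy (defpoly l) d (tri dd).
Proof.
case/and4P => hL.
case/and5P => d1 dd0 dd01 /eqP dsum /and5P[/eqP dd2 hr0 hr1 hr2 /andP[hh0 hh1]].
case/and5P => s0 s1 s2 q0 /and5P[q1 q2 k1 k2 hdet].
case/and5P => a0 ap rp hsp /andP[ms0 hms].
have [arr odt] := check_arrangement d1 hL.
have sL : size L = d by case/andP: hL => /eqP.
have fE := sprod_defpoly sL.
pose r (j c : 'I_3) : S := ev3 (tri (csyz K) j) c.
pose h (j : 'I_3) : S := ev (tri (h0, h1, h2) j).
pose kh (j : 'I_3) : nat := (dd.2.+1 - tri dd j)%N.
have hsyz j : is_syz (defpoly l) (r j).
  have gE c : ev3 (sgrad (sprod L)) c = mderiv c (defpoly l) by rewrite /ev3 -ev_der fE.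
  rewrite /is_syz /r; under eq_bigr => c _ do rewrite -gE.
  by elim/ord3P: j; rewrite triE; apply: szero_dot.
have hr j c : r j c \is (tri dd j).-homog.
  have h3 k x : shomog3 k x -> ev3 x c \is k.-homog.
    by case/and3P => x0 x1 x2; elim/ord3P: c; rewrite /ev3 triE; apply: ev_homog.
  by rewrite /r; elim/ord3P: j; rewrite !triE; apply: h3.
have hh j : [/\ h j \is (kh j).-homog, (0 < kh j)%N & dd.2.+1 = (kh j + tri dd j)%N].
  have l0 : (dd.1.1 <= dd.2)%N by rewrite dd2 leqW.
  have l1 : (dd.1.2 <= dd.2)%N by rewrite dd2.
  rewrite /h /kh; elim/ord3P: j; rewrite !triE; split; rewrite ?subn_gt0 ?ltnS ?subnK ?leqW //.
  - exact: ev_homog hh0.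
  - exact: ev_homog hh1.
  - by rewrite ev_lin subSnn; apply: linform_homog.
have hrel c : \sum_j h j * r j c = 0.
  have E : \sum_j h j * r j c = \sum_j ev3 (h0, h1, h2) j * ev3 (tri (col (csyz K)) c) j.
    by rewrite !big_ord3 /h /r /ev3 /col; elim/ord3P: c; rewrite !triE.
  by rewrite E; elim/ord3P: c {E}; rewrite triE; apply: szero_dot.
pose kap := zC (ckappa K).1 / zC (ckappa K).2.
have kap0 : kap != 0 by rewrite mulf_neq0 ?invr_eq0 ?zC_is0.
have hd : det3 (r o0) (r o1) euler = kap *: (h o2 * defpoly l).
  have := ev_zero hdet; rewrite ev_sub !ev_scale ev_mul ev_dot fE => /eqP.
  rewrite subr_eq0 => /eqP e.
  have -> : det3 (r o0) (r o1) euler = \sum_k ev3 sX k * ev3 (scross r0 r1) k.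
    by rewrite det3E big_ord3 !ev_X !ev_cross /r !triE.
  have z2 : zC (ckappa K).2 != 0 by rewrite zC_is0.
  rewrite /h triE /kap mulrC -scalerA -e scalerA mulVf // scale1r //.
have hr0' : exists c, ~ vanish (plane (zvC (cform K))) (r o0 c).
  have E := not_vanish_eval ap.
  move: rp; rewrite !negb_and => /or3P[] /E rp; [exists o0|exists o1|exists o2];
  by rewrite /r /ev3 !triE.
pose b := if cfirst K then o0 else o1; pose b' := if cfirst K then o1 else o0.
have hbE : ev (if cfirst K then h0 else h1) = h b by rewrite /h /b; case: (cfirst K); rewrite triE.
have hb'E : ev (if cfirst K then h1 else h0) = h b' by rewrite /h /b'; case: (cfirst K); rewrite triE.
have bb : (b = o0 /\ b' = o1) \/ (b = o1 /\ b' = o0) by rewrite /b /b'; case: (cfirst K); [left|right].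
pose ms := [seq zvC mp.1 | mp <- csplit K].
have hb : h b = \prod_(m <- ms) linform m + h o2 * ev (crest K).
  have := ev_zero hsp; rewrite ev_sub ev_add ev_mul ev_prod hbE => /eqP.
  by rewrite subr_eq0 => /eqP ->; rewrite /ms !big_map /h triE.
have ms' i : (i < size ms)%N -> indep (zvC (cform K)) (nth (fun=> 0) ms i) /\
     exists p, [/\ plane (zvC (cform K)) p, plane (nth (fun=> 0) ms i) p & (h b').@[p] != 0].
  rewrite size_map => hi; pose o := (BinNums.Z0, BinNums.Z0, BinNums.Z0).
  rewrite (nth_map (o, o)) //; set mp := nth _ _ _.
  have /allP /(_ mp (mem_nth _ hi)) /and4P[/zcrossP c1 c2 c3 c4] := hms.
  split=> //; exists (zvC mp.2); split; [exact: zis0_plane|exact: zis0_plane|].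
  by rewrite -hb'E ev_eval zC_is0.
have hb' : ~ vanish (plane (zvC (cform K))) (h b').
  have [|_ [p [p1 _ p3]]] := ms' 0%N; first by rewrite size_map.
  by move=> /(_ p p1) /eqP; rewrite (negbTE p3).
apply: (@cert_three_syzygy d l arr d1 (tri dd) r h kh dd.2.+1 _ hr hsyz hh hrel (zvC (cform K)) kap _ _ kap0 hd hr0' b b' ms (ev (crest K)) bb hb ms' hb').
- by rewrite !triE; split=> //; rewrite dd2.
- exact: znzP.
- by rewrite /h triE ev_lin.
Qed.

Lemma check_realized : check -> realized.
Proof.
move=> hc; have ts := check_three_syzygy hc.
case/and4P: hc => hL /and5P[d1 dd0 dd01 /eqP dsum /andP[/eqP dd2 _]] _ _.
have [arr odt] := check_arrangement d1 hL.
pose lR (i : 'I_d) (k : 'I_3) : R := (int_of_Z (tri (nthL i) k))%:~R.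
exists lR => /=.
have -> : (fun i k => RtoC (lR i k)) = l.
  apply/funext => i; apply/funext => k; rewrite /lR /l /zvC /zC.
  by rewrite -(rmorph_int (real_complex R)).
split=> //; exists (tri dd); split=> //; rewrite !triE //.
Qed.
End Check.

(** * The four arrangements *)

Local Open Scope Z_scope.

(** Two pencils of three lines, centred at [(1, 0, 0)] and [(0, 1, -1)], crossing in nine nodes. *)
Definition cert6 : certificate := Certificate
  [:: (0, 0, 1); (0, 1, - 1); (0, 1, 0); (1, - 1, - 1); (1, 0, 0); (1, 1, 1)]
  (([:: (1, (3, 0, 0)%N); (- 2, (1, 2, 0)%N); (- 2, (1, 1, 1)%N); (- 2, (1, 0, 2)%N)],
    [:: (- 1, (2, 1, 0)%N); (2, (0, 1, 2)%N)],
    [:: (- 1, (2, 0, 1)%N); (2, (0, 2, 1)%N)]),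
   ([:: (6, (3, 0, 0)%N); (- 10, (1, 2, 0)%N); (- 20, (1, 1, 1)%N); (- 10, (1, 0, 2)%N)],
    [:: (- 6, (2, 1, 0)%N); (2, (0, 3, 0)%N); (4, (0, 2, 1)%N); (2, (0, 1, 2)%N)],
    [:: (- 6, (2, 0, 1)%N); (2, (0, 2, 1)%N); (4, (0, 1, 2)%N); (2, (0, 0, 3)%N)]),
   ([:: (- 8, (3, 1, 0)%N); (4, (3, 0, 1)%N); (16, (1, 3, 0)%N); (12, (1, 2, 1)%N);
    (- 8, (1, 1, 2)%N); (- 4, (1, 0, 3)%N)],
    [:: (12, (2, 2, 0)%N); (- 12, (2, 1, 1)%N); (- 4, (0, 4, 0)%N); (- 4, (0, 3, 1)%N);
    (4, (0, 2, 2)%N); (4, (0, 1, 3)%N)],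
    [::]))
  ([:: (6, (2, 0, 0)%N); (- 2, (0, 2, 0)%N); (- 4, (0, 1, 1)%N); (- 2, (0, 0, 2)%N)],
   [:: (- 1, (2, 0, 0)%N); (2, (0, 2, 0)%N)])
  (0, 1, 1) true
  (24, 1)
  [:: ((6, 0, 0), (0, 1, - 1)); ((1, 0, 0), (0, 1, - 1))]
  [:: (- 2, (0, 1, 0)%N); (- 2, (0, 0, 1)%N)]
  (3, 3, - 3).

(** The six sides of a complete quadrangle, and the line [y = z], which meets them in six nodes. *)
Definition cert7 : certificate := Certificate
  [:: (0, 0, 1); (0, 1, - 1); (1, - 1, - 1); (1, - 1, 0); (1, 0, 0); (1, 1, 0); (1, 1, 1)]
  (([:: (- 1, (3, 0, 0)%N); (7, (1, 2, 0)%N); (- 5, (1, 1, 1)%N); (- 4, (1, 0, 2)%N)],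
    [:: (6, (2, 1, 0)%N); (- 7, (2, 0, 1)%N); (2, (0, 2, 1)%N); (- 4, (0, 1, 2)%N)],
    [:: (- 1, (2, 0, 1)%N); (- 7, (0, 2, 1)%N); (2, (0, 1, 2)%N); (3, (0, 0, 3)%N)]),
   ([:: (- 3, (3, 0, 1)%N); (6, (1, 3, 0)%N); (- 6, (1, 1, 2)%N)],
    [:: (7, (2, 2, 0)%N); (- 3, (2, 1, 1)%N); (- 7, (2, 0, 2)%N); (- 1, (0, 4, 0)%N);
    (1, (0, 2, 2)%N)],
    [:: (- 7, (2, 1, 1)%N); (4, (2, 0, 2)%N); (- 1, (0, 3, 1)%N); (1, (0, 1, 3)%N)]),
   ([:: (7, (5, 0, 0)%N); (- 42, (3, 2, 0)%N); (7, (3, 0, 2)%N); (35, (1, 4, 0)%N);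
    (28, (1, 3, 1)%N); (- 21, (1, 2, 2)%N); (- 14, (1, 1, 3)%N)],
    [:: (- 35, (4, 1, 0)%N); (35, (4, 0, 1)%N); (42, (2, 3, 0)%N); (- 21, (2, 1, 2)%N);
    (- 21, (2, 0, 3)%N); (- 7, (0, 5, 0)%N); (- 7, (0, 4, 1)%N); (7, (0, 3, 2)%N);
    (7, (0, 2, 3)%N)],
    [::]))
  ([:: (- 7, (2, 1, 0)%N); (4, (2, 0, 1)%N); (- 1, (0, 3, 0)%N); (1, (0, 1, 2)%N)],
   [:: (1, (2, 0, 0)%N); (7, (0, 2, 0)%N); (- 2, (0, 1, 1)%N); (- 3, (0, 0, 2)%N)])
  (0, - 1, 1) true
  (49, 1)
  [:: ((- 3, 0, 0), (0, - 1, - 1)); ((1, 0, 0), (0, 1, 1)); ((0, 1, 0), (- 1, 0, 0))]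
  [:: (4, (2, 0, 0)%N); (1, (0, 2, 0)%N); (1, (0, 1, 1)%N)]
  (3, 3, 3).

(** The lines of [cert9] without [x + y = 0], which carries three of their triple points. *)
Definition cert8 : certificate := Certificate
  [:: (0, 0, 1); (0, 1, - 1); (0, 1, 0); (1, - 1, 0); (1, - 1, 1); (1, 0, - 1); (1, 0, 1);
    (1, 1, - 1)]
  (([:: (3, (4, 0, 0)%N); (- 4, (3, 1, 0)%N); (- 4, (2, 2, 0)%N); (9, (2, 1, 1)%N);
    (- 9, (2, 0, 2)%N); (5, (1, 3, 0)%N); (- 12, (1, 2, 1)%N); (12, (1, 1, 2)%N)],
    [:: (- 5, (3, 1, 0)%N); (4, (2, 2, 0)%N); (4, (1, 3, 0)%N); (- 15, (1, 2, 1)%N);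
    (15, (1, 1, 2)%N); (- 3, (0, 4, 0)%N); (12, (0, 3, 1)%N); (- 12, (0, 2, 2)%N)],
    [:: (- 5, (3, 0, 1)%N); (4, (2, 1, 1)%N); (- 4, (1, 2, 1)%N); (9, (1, 1, 2)%N);
    (- 1, (1, 0, 3)%N); (5, (0, 3, 1)%N); (- 12, (0, 2, 2)%N); (4, (0, 1, 3)%N)]),
   ([:: (21, (4, 0, 0)%N); (- 28, (3, 1, 0)%N); (- 32, (2, 2, 0)%N); (71, (2, 1, 1)%N);
    (- 63, (2, 0, 2)%N); (15, (1, 3, 0)%N); (- 56, (1, 2, 1)%N); (120, (1, 1, 2)%N);
    (- 24, (1, 0, 3)%N)],
    [:: (- 35, (3, 1, 0)%N); (- 4, (2, 2, 0)%N); (64, (2, 1, 1)%N); (24, (1, 3, 0)%N);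
    (- 97, (1, 2, 1)%N); (105, (1, 1, 2)%N); (- 9, (0, 4, 0)%N); (48, (0, 3, 1)%N);
    (- 48, (0, 2, 2)%N); (- 24, (0, 1, 3)%N)],
    [:: (- 35, (3, 0, 1)%N); (92, (2, 1, 1)%N); (- 32, (2, 0, 2)%N); (- 32, (1, 2, 1)%N);
    (71, (1, 1, 2)%N); (- 7, (1, 0, 3)%N); (15, (0, 3, 1)%N); (- 56, (0, 2, 2)%N);
    (8, (0, 0, 4)%N)]),
   ([:: (- 333, (5, 0, 0)%N); (468, (4, 1, 0)%N); (- 120, (4, 0, 1)%N); (528, (3, 2, 0)%N);
    (- 975, (3, 1, 1)%N); (1095, (3, 0, 2)%N); (- 591, (2, 3, 0)%N); (1488, (2, 2, 1)%N);
    (- 2040, (2, 1, 2)%N); (480, (2, 0, 3)%N); (- 360, (1, 2, 2)%N); (384, (1, 1, 3)%N);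
    (- 384, (1, 0, 4)%N); (768, (0, 3, 2)%N); (- 1536, (0, 2, 3)%N); (768, (0, 1, 4)%N)],
    [:: (555, (4, 1, 0)%N); (- 324, (3, 2, 0)%N); (- 120, (3, 1, 1)%N); (- 360, (2, 3, 0)%N);
    (1113, (2, 2, 1)%N); (- 1569, (2, 1, 2)%N); (201, (1, 4, 0)%N); (- 600, (1, 3, 1)%N);
    (1008, (1, 2, 2)%N); (- 480, (1, 1, 3)%N); (24, (0, 3, 2)%N); (- 192, (0, 2, 3)%N);
    (384, (0, 1, 4)%N)],
    [:: (555, (4, 0, 1)%N); (- 804, (3, 1, 1)%N); (360, (3, 0, 2)%N); (- 48, (2, 2, 1)%N);
    (- 591, (2, 1, 2)%N); (- 177, (2, 0, 3)%N); (177, (1, 3, 1)%N); (- 48, (1, 2, 2)%N);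
    (216, (0, 2, 3)%N)]))
  ([:: (76, (2, 0, 0)%N); (- 50, (1, 1, 0)%N); (68, (1, 0, 1)%N); (24, (0, 2, 0)%N);
    (- 80, (0, 1, 1)%N); (- 32, (0, 0, 2)%N)],
   [:: (5, (2, 0, 0)%N); (6, (1, 1, 0)%N); (- 4, (1, 0, 1)%N); (- 8, (0, 2, 0)%N);
    (16, (0, 1, 1)%N)])
  (1, 0, 0) false
  (- 768, 1)
  [:: ((0, - 8, 0), (0, 0, - 1)); ((0, 1, - 2), (0, 2, 1))]
  [:: (5, (1, 0, 0)%N); (6, (0, 1, 0)%N); (- 4, (0, 0, 1)%N)]
  (0, 3, 3).

(** In the chart [z = 1]: the line at infinity and two parallel lines in each of four directions. *)
Definition cert9 : certificate := Certificate
  [:: (0, 0, 1); (0, 1, - 1); (0, 1, 0); (1, - 1, 0); (1, - 1, 1); (1, 0, - 1); (1, 0, 1);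
    (1, 1, - 1); (1, 1, 0)]
  (([:: (- 2, (1, 3, 0)%N); (3, (1, 2, 1)%N); (3, (1, 1, 2)%N); (- 2, (1, 0, 3)%N)],
    [:: (- 3, (2, 2, 0)%N); (6, (2, 1, 1)%N); (1, (0, 4, 0)%N); (- 3, (0, 3, 1)%N);
    (3, (0, 2, 2)%N); (- 2, (0, 1, 3)%N)],
    [:: (6, (2, 1, 1)%N); (- 3, (2, 0, 2)%N); (- 2, (0, 3, 1)%N); (3, (0, 2, 2)%N);
    (- 3, (0, 1, 3)%N); (1, (0, 0, 4)%N)]),
   ([:: (1, (5, 0, 0)%N); (- 3, (3, 2, 0)%N); (3, (3, 1, 1)%N); (- 3, (3, 0, 2)%N);
    (2, (1, 4, 0)%N); (- 5, (1, 3, 1)%N); (5, (1, 2, 2)%N)],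
    [:: (- 2, (4, 1, 0)%N); (3, (2, 3, 0)%N); (- 6, (2, 2, 1)%N); (6, (2, 1, 2)%N);
    (- 1, (0, 5, 0)%N); (4, (0, 4, 1)%N); (- 4, (0, 3, 2)%N)],
    [:: (- 2, (4, 0, 1)%N); (3, (2, 1, 2)%N); (2, (0, 4, 1)%N); (- 5, (0, 3, 2)%N);
    (2, (0, 2, 3)%N)]),
   ([:: (- 3, (6, 0, 0)%N); (10, (4, 2, 0)%N); (- 10, (4, 1, 1)%N); (10, (4, 0, 2)%N);
    (- 7, (2, 4, 0)%N); (18, (2, 3, 1)%N); (- 27, (2, 2, 2)%N); (8, (2, 1, 3)%N);
    (- 3, (2, 0, 4)%N); (9, (0, 4, 2)%N); (- 18, (0, 3, 3)%N); (9, (0, 2, 4)%N)],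
    [:: (6, (5, 1, 0)%N); (- 8, (3, 3, 0)%N); (14, (3, 2, 1)%N); (- 20, (3, 1, 2)%N);
    (2, (1, 5, 0)%N); (- 6, (1, 4, 1)%N); (12, (1, 3, 2)%N); (- 10, (1, 2, 3)%N); (6, (1, 1, 4)%N)],
    [:: (6, (5, 0, 1)%N); (- 8, (3, 2, 1)%N); (- 4, (3, 1, 2)%N); (- 2, (3, 0, 3)%N);
    (2, (1, 4, 1)%N); (2, (1, 1, 4)%N)]))
  ([:: (1, (2, 1, 0)%N); (- 1, (0, 3, 0)%N); (2, (0, 2, 1)%N)],
   [:: (3, (2, 0, 0)%N); (- 1, (0, 2, 0)%N); (1, (0, 1, 1)%N); (- 1, (0, 0, 2)%N)])
  (1, 0, 0) true
  (27, 1)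
  [:: ((0, - 1, 0), (0, 0, - 1)); ((0, 1, 0), (0, 0, 1)); ((0, 1, - 2), (0, 2, 1))]
  [:: (1, (1, 1, 0)%N)]
  (0, 3, 3).

Local Close Scope Z_scope.

Lemma realized6 : realized 6.
Proof. by apply: (@check_realized 6 (3, 3, 4)%N cert6); vm_compute. Qed.

Lemma realized7 : realized 7.
Proof. by apply: (@check_realized 7 (3, 4, 5)%N cert7); vm_compute. Qed.

Lemma realized8 : realized 8.
Proof. by apply: (@check_realized 8 (4, 4, 5)%N cert8); vm_compute. Qed.

Lemma realized9 : realized 9.
Proof. by apply: (@check_realized 9 (4, 5, 6)%N cert9); vm_compute. Qed.

Local Close Scope ring_scope.

Theorem theoremA :
  (forall (d : nat) (l : 'I_d -> 'I_3 -> C),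
      line_arrangement l -> only_double_triple l ->
      minimal_plus_one_generated (defpoly l) d ->
      (d, nmult l 2, nmult l 3) \in MPOG_weak_combinatorics) /\
  (forall (d n2 n3 : nat), (d, n2, n3) \in MPOG_weak_combinatorics ->
      exists lR : 'I_d -> 'I_3 -> R,
        let l := fun i k => RtoC (lR i k) in
        [/\ line_arrangement l, only_double_triple l,
            minimal_plus_one_generated (defpoly l) d,
            nmult l 2 = n2 & nmult l 3 = n3]).
Proof.
split; first by move=> d l arr odt; apply: part_one.
move=> d n2 n3; rewrite !inE !xpair_eqE => h.
have [lR [arr odt mp]] : realized d.
  by case/or4P: h => /andP[/andP[/eqP -> _] _];
    [exact: realized6|exact: realized7|exact: realized8|exact: realized9].
(* The four entries differ in [d], so the classification itself determines [n_2] and [n_3]; the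
   double and triple points of the explicit arrangements need not be counted. *)
exists lR; have h' := part_one arr odt mp.
suff [e2 e3] : nmult (fun i k => RtoC (lR i k)) 2 = n2 /\ nmult (fun i k => RtoC (lR i k)) 3 = n3.
  by split.
move: h'; rewrite !inE !xpair_eqE; move: (nmult _ 2) (nmult _ 3) h => a b; clear.
by case/or4P => /andP[/andP[/eqP -> /eqP ->] /eqP ->] /or4P[] /andP[/andP[// _ /eqP ->] /eqP ->].
Qed.
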